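(* Let $X,Y,Z$ be Polish spaces, let $c\in C(X\times Y)$ be a continuous cost that is bounded below ($\inf c>-\infty$), and let $\rho=\rho(x,z)=\rho(x|z)\nu(z)\in P(X\times Z)$ be a probability measure with $Z$-marginal $\nu$ and conditional distributions $\rho(\cdot|z)$. Then: 1. For any $\mu\in P(Y)$, the total transport cost $\int_Z I_c(\rho(\cdot|z),\mu)\,d\nu(z)$ is well-defined, and $$\int_{Z} I_c(\rho(\cdot|z),\mu)\, d\nu(z) = \min_{\substack{\pi \in P(X\times Y\times Z)\\ \pi_{XZ} = \rho\\ \pi_{YZ} = \mu \otimes \nu}} \int_{X\times Y\times Z} c(x,y)\, d\pi(x,y,z),$$ so in particular the minimum on the right-hand side is attained. 2. Suppose in addition that $c$ is locally uniformly coercive and that $Y$ satisfies the Heine-Borel property. Then there exists a barycenter $\mu\in P(Y)$ of $\rho(x,z)$. Specifically, $$\min_{\mu \in P(Y)} \int_{Z} I_c(\rho(\cdot|z),\mu)\, d\nu(z) = \min_{\substack{\pi \in P(X\times Y\times Z)\\ \pi_{XZ} = \rho\\ \pi_{YZ} = \pi_Y \otimes \pi_Z}} \int_{X\times Y\times Z} c(x,y)\, d\pi(x,y,z)$$ (both minima being attained), and the marginal $\pi_Y$ of every minimizer $\pi$ of the right-hand side is a barycenter.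
   Context: $P(X)$ denotes the set of Borel probability measures on $X$. For a joint measure $\pi$, $\pi_{XZ},\pi_{YZ},\pi_Y,\pi_Z$ etc. denote its marginals on the indicated factors. The conditionals $\rho(\cdot|z)$ are given by disintegration of $\rho$ with respect to its $Z$-marginal $\nu$: a Borel measurable map $Z\to P(X)$ (weak topology), unique $\nu$-a.e. For $\rho_1\in P(X)$, $\mu\in P(Y)$, the optimal transport cost is $I_c(\rho_1,\mu)=\inf\{\int_{X\times Y} c\,d\pi:\ \pi\in P(X\times Y),\ \pi_X=\rho_1,\ \pi_Y=\mu\}$ (with value in $(-\infty,\infty]$). The total transport cost between $\rho(x,z)$ and $\mu\in P(Y)$ is $\int_Z I_c(\rho(\cdot|z),\mu)\,d\nu(z)$. A barycenter of $\rho(x,z)$ is a $\mu\in P(Y)$ that attains the infimum of the total transport cost over $P(Y)$. With $d$ the metric of $Y$: the cost $c$ is locally uniformly coercive if for some (and thus every) $y_0\in Y$ and every compact $K\subseteq X$, $\lim_{d(y,y_0)\to\infty}\inf_{x\in K}c(x,y)=\infty$, where the limit is taken over all sequences in $Y$. The space $Y$ satisfies the Heine-Borel property if every closed bounded subset of $Y$ is compact. *)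

(* Defs.v *)
From HB Require Import structures.
From mathcomp Require Import all_boot all_order all_algebra.
From mathcomp Require Import all_classical all_reals all_analysis.
From mathcomp Require Import measurable_realfun giry.

Set Implicit Arguments.
Unset Strict Implicit.
Unset Printing Implicit Defensive.
Import Order.TTheory GRing.Theory Num.Theory.
Import numFieldNormedType.Exports.

Local Open Scope classical_set_scope.
Local Open Scope ring_scope.

(* A Polish space carries a fixed complete metric [mdist] inducing its topology,
   and its measurable sets are the Borel sets. It is nonempty, because both
   [Complete] and [Measurable] are pointed. *)
HB.mixin Record isPolish (R : realType) (d : measure_display) T
    & Metric R T & Measurable d T := {
  polish_separable : exists2 S : set T, countable S & dense S ;
  polish_borel : @measurable d T = <<s @open T >> }.

#[short(type="polishType")]
HB.structure Definition Polish (R : realType) (d : measure_display) :=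
  {T of Metric R T & Complete T & Measurable d T & isPolish R d T}.

(* The library gives [X * Y] the product topology and the product of the two
   sigma-algebras; [polish_prod_borel] shows that for Polish spaces the latter
   is the Borel sigma-algebra of the former. *)
Lemma polish_countable_basis (R : realType) d (T : polishType R d) :
  exists2 B : nat * nat -> set T, (forall n, open (B n)) &
    forall (O : set T) x, open O -> O x -> exists2 n, B n x & B n `<=` O.
Proof.
have [S /pcard_surjP[s sS] dS] := @polish_separable R d T.
exists (fun p => (ball (s p.1) ((p.2.+1%:R : R)^-1 *+ 2))°).
  by move=> n; exact: open_interior.
move=> O x oO Ox.
have : nbhs x O by exact: open_nbhs_nbhs.
move=> /nbhs_ballP[e /= e0 eO].
have [n ne] : exists n : nat, (n.+1%:R : R)^-1 *+ 3 < e.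
  exists (Num.truncn (3 / e)).
  rewrite -[ltLHS]mulr_natl ltr_pdivrMr// mulrC -ltr_pdivrMr//.
  exact: truncnS_gt.
set r : R := n.+1%:R^-1 in ne *.
have r0 : 0 < r by rewrite invr_gt0.
have [y [] yx] : (ball x r)° `&` S !=set0.
  by apply: dS; [exists x; exact: nbhsx_ballx|exact: open_interior].
move=> /sS[m _ my]; move/interior_subset : yx => xy; rewrite -my in xy.
exists (m, n) => /=; rewrite -/r.
  apply/nbhs_ballP; exists r => //= z xz; rewrite mulr2n.
  by apply: ball_triangle xz; exact: ball_sym.
move=> z /interior_subset mz; apply: eO.
by apply: le_ball (ball_triangle xy mz); rewrite -mulrS ltW.
Qed.

Lemma polish_prod_borel (R : realType) dX dY
    (X : polishType R dX) (Y : polishType R dY) :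
  @measurable _ (X * Y)%type = <<s @open (X * Y)%type >>.
Proof.
rewrite eqEsubset; split.
  apply: smallest_sub; first exact: smallest_sigma_algebra.
  have H d (T : polishType R d) (f : X * Y -> T) (A : set T) :
      continuous f -> measurable A -> <<s @open (X * Y)%type >> (f @^-1` A).
    move=> cf; rewrite polish_borel => mA; rewrite -[_ @^-1` _]setTI.
    apply: (@measurability _ _ (g_sigma_algebraType (@open (X * Y)%type)) (g_sigma_algebraType (@open T)) setT f (@open T)) => //.
      move=> _ [B oB <-]; rewrite setTI; apply: sub_gen_smallest.
      by move/continuousP : cf; exact.
  move=> _ [[A mA <-]|[A mA <-]]; rewrite setTI.
    by apply: H mA => -[x y]; exact: cvg_fst.
  by apply: H mA => -[x y]; exact: cvg_snd.
apply: smallest_sub; first exact: sigma_algebra_measurable.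
move=> O oO.
have [B oB bB] := @polish_countable_basis R dX X.
have [C oC bC] := @polish_countable_basis R dY Y.
pose F p := if `[< B p.1 `*` C p.2 `<=` O >] then B p.1 `*` C p.2 else set0.
have -> : O = \bigcup_p F p.
  rewrite eqEsubset; split=> [[x y] Oxy|xy [p _]]; last first.
    by rewrite /F; case: asboolP => //; exact.
  have : nbhs (x, y) O by exact: open_nbhs_nbhs.
  move=> [[U V] /= [nU nV] UVO].
  have [i Bi BiU] := bB _ x (open_interior U) nU.
  have [j Cj CjV] := bC _ y (open_interior V) nV.
  exists (i, j) => //; rewrite /F; case: asboolP => //=.
  apply: contra_notP => _ [u v] /= [/BiU/interior_subset ? /CjV/interior_subset ?].
  exact: UVO.
apply: countable_bigcupT_measurable => // p; rewrite /F.
case: asboolP => // _; apply: measurableX; rewrite polish_borel;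
  exact: sub_gen_smallest.
Qed.

Section projections.
Context {dX dY dZ : measure_display}.
Context {X : measurableType dX} {Y : measurableType dY} {Z : measurableType dZ}.

Definition projfst (p : X * Y) : X := p.1.
Definition projsnd (p : X * Y) : Y := p.2.
Definition projY (p : X * Y * Z) : Y := p.1.2.
Definition projXZ (p : X * Y * Z) : X * Z := (p.1.1, p.2).
Definition projYZ (p : X * Y * Z) : Y * Z := (p.1.2, p.2).

Let measurable_projfst : measurable_fun setT projfst.
Proof. exact: measurable_fst. Qed.
Let measurable_projsnd : measurable_fun setT projsnd.
Proof. exact: measurable_snd. Qed.
Let measurable_projY : measurable_fun setT projY.
Proof. exact: (measurableT_comp measurable_snd measurable_fst). Qed.
Let measurable_projXZ : measurable_fun setT projXZ.
Proof.
apply: measurable_fun_pair => //.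
exact: (measurableT_comp measurable_fst measurable_fst).
Qed.
Let measurable_projYZ : measurable_fun setT projYZ.
Proof. exact: measurable_fun_pair. Qed.

HB.instance Definition _ := isMeasurableFun.Build _ _ _ _ projfst measurable_projfst.
HB.instance Definition _ := isMeasurableFun.Build _ _ _ _ projsnd measurable_projsnd.
HB.instance Definition _ := isMeasurableFun.Build _ _ _ _ projY measurable_projY.
HB.instance Definition _ := isMeasurableFun.Build _ _ _ _ projXZ measurable_projXZ.
HB.instance Definition _ := isMeasurableFun.Build _ _ _ _ projYZ measurable_projYZ.

End projections.

Section weak_topology.
Context {R : realType} {d : measure_display} (X : polishType R d).

Definition bounded_continuous : Type :=
  {f : X -> R | continuous f /\ exists M, forall x, `|f x| <= M}.

(* The coarsest topology making the integration of every bounded continuous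
   function continuous. *)
Definition weak_topology : topologicalType :=
  sup_topology (fun f : bounded_continuous =>
    Topological.on (initial_topology
      (fun m : probability X R => \int[m]_x (sval f) x))).

Definition weak_borel := g_sigma_algebraType (@open weak_topology).

End weak_topology.

Local Open Scope ereal_scope.

(* Measures are compared by [measure_eq], i.e. on measurable sets only, because
   the value of a library measure on a non-measurable set is arbitrary. *)

Section optimal_transport.
Context {R : realType} {dX dY dZ : measure_display}.
Context {X : polishType R dX} {Y : polishType R dY} {Z : polishType R dZ}.
Implicit Types (c : X * Y -> R) (rho : probability (X * Z)%type R).
Implicit Types (mu : probability Y R) (nu : probability Z R).

(* The conditionals of [rho] are a Borel map into the probability measures with
   the weak topology; rectangles determine a measure on [X * Z]. *)
Definition is_disintegration rho nu (kappa : Z -> probability X R) :=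
  measurable_fun [set: Z] (kappa : Z -> weak_borel X) /\
  forall A B, measurable A -> measurable B ->
    rho (A `*` B) = \int[nu]_(z in B) kappa z A.

Definition couplings (rho1 : probability X R) mu : set (probability (X * Y)%type R) :=
  [set pi | distribution pi projfst ≡μ rho1 /\ distribution pi projsnd ≡μ mu].

Definition transport_cost c (rho1 : probability X R) mu : \bar R :=
  ereal_inf [set \int[pi]_p (c p)%:E | pi in couplings rho1 mu].

Definition total_cost c nu (kappa : Z -> probability X R) mu : \bar R :=
  \int[nu]_z transport_cost c (kappa z) mu.

Definition is_barycenter c nu kappa mu :=
  forall mu', total_cost c nu kappa mu <= total_cost c nu kappa mu'.

Definition triple_cost c (pi : probability (X * Y * Z)%type R) : \bar R :=
  \int[pi]_p (c p.1)%:E.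

Definition plans_to rho nu mu : set (probability (X * Y * Z)%type R) :=
  [set pi | distribution pi projXZ ≡μ rho /\
            distribution pi projYZ ≡μ (mu \x nu)].

Definition plans rho : set (probability (X * Y * Z)%type R) :=
  [set pi | distribution pi projXZ ≡μ rho /\
            distribution pi projYZ ≡μ
              (distribution pi projY \x distribution pi projsnd)].

Definition locally_uniformly_coercive c :=
  exists y0 : Y, forall K : set X, compact K -> forall u : nat -> Y,
    mdist (u n) y0 @[n --> \oo] --> +oo%R ->
    ereal_inf [set (c (x, u n))%:E | x in K] @[n --> \oo] --> +oo.

End optimal_transport.

Definition heine_borel (R : realType) (T : metricType R) :=
  forall A : set T, closed A ->
    (exists x0 r, forall x, A x -> (mdist x0 x <= r)%R) -> compact A.

(* The integral of [f] exists and is greater than -oo; it may be +oo. *)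
Definition integral_well_defined (R : realType) d (T : measurableType d)
    (m : probability T R) (f : T -> \bar R) :=
  measurable_fun [set: T] f /\ \int[m]_x f^\- x < +oo.

Definition is_minimum (R : realType) (A : set (\bar R)) (v : \bar R) :=
  A v /\ lbound A v.

(* Main.v *)
Require Import Defs.
From HB Require Import structures.
From mathcomp Require Import all_boot all_order all_algebra.
From mathcomp Require Import all_classical all_reals all_analysis.
From mathcomp Require Import measurable_realfun giry lra ring.

(* Subtracting a lower bound, let c >= 0. Then c is the increasing limit of
   costs c_n = max_(k < n) q_k 1_(U_k * V_k), which see x only through the
   finitely many cells cut out by U_0, .., U_(n-1). For such a cost a law on X
   matters only through its cell masses. Round these masses to a finite grid,
   fix one nearly optimal coupling with mu per grid point, and let J_n(kap) be
   the cost of transporting kap along the conditional laws of the coupling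
   chosen for kap. Up to 1/n, J_n bounds from below the cost of every coupling
   of kap and mu, and, integrated against nu, that of every plan over rho and
   mu. Conversely, as z |-> grid point of kappa_z has finitely many values, the
   chosen couplings glue to a plan of c_n-cost int J_n(kappa_z) dnu whose
   YZ-marginal is 1/n-close to mu * nu: no measurable selection is needed.
   A tight sequence of plans has a limit plan (take the limit along an
   ultrafilter, then regularise it to a measure), and costs are lower
   semicontinuous along it. With Z reduced to a point this yields
   I_c(kap, mu) = liminf J_n(kap), hence measurability, and Fatou's lemma bounds
   int I_c dnu by the cost of every plan; over rho it yields a plan attaining
   the bound. For the barycenter, coercivity and the Heine-Borel property make
   the Y-marginals of a minimizing sequence tight. *)

Set Implicit Arguments.
Unset Strict Implicit.
Unset Printing Implicit Defensive.
Import Order.TTheory GRing.Theory Num.Theory.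
Import numFieldNormedType.Exports.

Local Open Scope classical_set_scope.
Local Open Scope ring_scope.

(** * Products of Polish spaces *)

(** Only the YZ-constraint is relaxed: y is drawn from a law that depends on (x, z) through the cell
    of x and the grid point of kappa_z, so elementary conditioning on finitely many events suffices
    and the XZ-marginal stays exactly [rho]. Independence of Y and Z survives up to the mesh because
    every realised grid point is served by a coupling with the same second marginal mu. The error is
    one rounding error per cell, so the mesh is taken small against the number of cells and the
    bound of c_n. Cost and grid both change with n, and nothing makes J_n monotone in n; only its
    liminf is meaningful. Hence the construction of a plan assumes good indices arbitrarily far out,
    not a convergent sequence. The blocks of c_n are products of open sets because a limit of
    probabilities is controlled in one direction on open sets. This direction is the one that lower
    semicontinuity of the cost needs, and it is why measures are identified below from inequalities
    on open sets alone. *)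

Section prod_polish.
Context {R : realType}.

Section prod_metric.
Context (X Y : metricType R).
Implicit Types p q : (X * Y)%type.

(** The maximum, because its balls are the product balls already in place, so that the topology of
    the product is kept. *)
Definition prod_mdist p q : R := Num.max (mdist p.1 q.1) (mdist p.2 q.2).

Lemma prod_mdist_ge0 p q : 0 <= prod_mdist p q.
Proof. by rewrite le_max mdist_ge0. Qed.

Lemma prod_mdist_positivity p q : prod_mdist p q = 0 -> p = q.
Proof.
case: p q => [x y] [x' y'] /= /eqP; rewrite eq_le ge_max /= => /andP[/andP[h1 h2] _].
by congr pair; apply: mdist_positivity; apply/eqP; rewrite eq_le mdist_ge0 andbT.
Qed.

Lemma prod_ballEmdist p d : ball p d = [set q | prod_mdist p q < d].
Proof.
apply/seteqP; split=> q; rewrite /ball/= /prod_ball /prod_mdist !ballEmdist/= gt_max.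
  by move=> [-> ->].
by move=> /andP[].
Qed.

HB.instance Definition _ := PseudoMetric_isMetric.Build R (X * Y)%type
  prod_mdist_ge0 prod_mdist_positivity prod_ballEmdist.

End prod_metric.

Section prod_complete.
Context {dX dY} (X : polishType R dX) (Y : polishType R dY).

HB.instance Definition _ := Pointed.on (X * Y)%type.

Lemma prod_complete (F : set_system (X * Y)) :
  ProperFilter F -> cauchy F -> cvg F.
Proof.
move=> FF /cauchy_ballP cF.
have c1 : cvg (fst @ F).
  apply: cauchy_cvg; apply/cauchy_ballP => e e0.
  have [[A B] /= [FA FB] AB] := cF _ e0.
  exists (fst @` A, fst @` B); first split; rewrite /= /fmap/=.
  - by apply: filterS FA => p Ap; exists p.
  - by apply: filterS FB => p Ap; exists p.
  by move=> [x y] [/= [p Ap <-] [q Aq <-]]; have /= := AB (p, q) (conj Ap Aq) => -[].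
have c2 : cvg (snd @ F).
  apply: cauchy_cvg; apply/cauchy_ballP => e e0.
  have [[A B] /= [FA FB] AB] := cF _ e0.
  exists (snd @` A, snd @` B); first split; rewrite /= /fmap/=.
  - by apply: filterS FA => p Ap; exists p.
  - by apply: filterS FB => p Ap; exists p.
  by move=> [x y] [/= [p Ap <-] [q Aq <-]]; have /= := AB (p, q) (conj Ap Aq) => -[].
apply/cvg_ex; exists (lim (fst @ F), lim (snd @ F)).
apply/fcvg_ballP => e e0; near=> p; split.
  by near: p; move/cvg_ballP : c1; exact.
by near: p; move/cvg_ballP : c2; exact.
Unshelve. all: by end_near.
Qed.

HB.instance Definition _ := Uniform_isComplete.Build (X * Y)%type prod_complete.

Lemma prod_separable : exists2 S : set (X * Y), countable S & dense S.
Proof.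
have [S cS dS] := @polish_separable R dX X.
have [S' cS' dS'] := @polish_separable R dY Y.
exists (S `*` S'); first exact: countableX.
move=> O [[x y] Oxy] oO.
have : nbhs (x, y) O by exact: open_nbhs_nbhs.
move=> [[U V] /= [nU nV] UVO].
have [a [Ua Sa]] : U° `&` S !=set0.
  by apply: dS; [exists x|exact: open_interior].
have [b [Vb Sb]] : V° `&` S' !=set0.
  by apply: dS'; [exists y|exact: open_interior].
exists (a, b); split=> //; apply: UVO; split=> /=; exact: interior_subset.
Qed.

HB.instance Definition _ := isPolish.Build R _ (X * Y)%type
  prod_separable (polish_prod_borel X Y).

End prod_complete.
End prod_polish.

Local Open Scope ereal_scope.

Lemma open_measurable_polish (R : realType) d (W : polishType R d) (U : set W) :
  open U -> measurable U.
Proof. by move=> oU; rewrite polish_borel; exact: sub_gen_smallest. Qed.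

Lemma closed_measurable_polish (R : realType) d (W : polishType R d) (U : set W) :
  closed U -> measurable U.
Proof.
by move=> cU; rewrite -[U]setCK; apply/measurableC/open_measurable_polish/closed_openC.
Qed.

Lemma compact_closed_polish (R : realType) d (W : polishType R d) (K : set W) :
  compact K -> closed K.
Proof. exact: (compact_closed (@metric_hausdorff _ _)). Qed.

Lemma compact_measurable_polish (R : realType) d (W : polishType R d) (K : set W) :
  compact K -> measurable K.
Proof. by move=> /compact_closed_polish; exact: closed_measurable_polish. Qed.

(** * Limits of tight sequences *)

Section content_measure.
Context {R : realType} {d} (W : polishType R d) (p : set W -> R).
Hypothesis p_ge0 : forall A, measurable A -> (0 <= p A)%R.
Hypothesis pU : forall A B, measurable A -> measurable B -> A `&` B = set0 ->
  p (A `|` B) = (p A + p B)%R.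
Hypothesis pT : p setT = 1%R.
Hypothesis ptight : forall e : R, (0 < e)%R -> exists2 K, compact K & (1 - e <= p K)%R.

Let omeas := @open_measurable_polish R d W.

Let p_set0 : p set0 = 0%R.
Proof.
have := pU measurable0 measurable0 (setI0 _); rewrite setU0 => /eqP.
by rewrite -subr_eq0 opprD addNKr oppr_eq0 => /eqP.
Qed.

Let p_le A B : measurable A -> measurable B -> A `<=` B -> (p A <= p B)%R.
Proof.
move=> mA mB AB; rewrite -(setDUK AB) pU//.
- by rewrite lerDl p_ge0//; exact: measurableD.
- exact: measurableD.
- by rewrite setDE setICA setICr setI0.
Qed.

Let p_sub A B : measurable A -> measurable B -> (p (A `|` B) <= p A + p B)%R.
Proof.
move=> mA mB; have -> : A `|` B = A `|` (B `\` A).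
  by apply/seteqP; split=> x /=; have := EM (A x); tauto.
rewrite pU//; [|exact: measurableD|exact: setDIK].
by rewrite lerD2l; apply: p_le => //; first [exact: measurableD|exact: subDsetl].
Qed.

(* As [p] is only finitely additive, it is first regularised on open sets from
   inside by compact sets; for the induced outer measure open sets are
   Caratheodory measurable, and tightness keeps the total mass 1. *)
Definition compact_content (K : set W) : \bar R :=
  ereal_inf [set (p U)%:E | U in [set U | open U /\ K `<=` U]].
Definition open_content (U : set W) : \bar R :=
  ereal_sup [set compact_content K | K in [set K | compact K /\ K `<=` U]].
Definition outer_content (A : set W) : \bar R :=
  ereal_inf [set open_content U | U in [set U | open U /\ A `<=` U]].

Let compact_content_le K U : open U -> K `<=` U -> compact_content K <= (p U)%:E.
Proof. by move=> oU KU; apply: ereal_inf_lbound; exists U. Qed.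

Let compact_content_ge0 K : 0 <= compact_content K.
Proof.
apply: le_ereal_inf_tmp => _ [U [oU _] <-].
by rewrite lee_fin p_ge0//; exact: omeas.
Qed.

Let compact_content_fin K : compact_content K \is a fin_num.
Proof.
rewrite ge0_fin_numE//; apply: le_lt_trans (ltry 1).
by rewrite -pT compact_content_le//; exact: openT.
Qed.

Let compact_contentP K (e : R) : (0 < e)%R ->
  exists U, [/\ open U, K `<=` U & (p U)%:E <= compact_content K + e%:E].
Proof.
move=> e0; have [_ [U [oU KU] <-] /ltW] := lb_ereal_inf_adherent e0 (compact_content_fin K).
by exists U.
Qed.

Let compact_contentU K1 K2 : compact_content (K1 `|` K2) <= compact_content K1 + compact_content K2.
Proof.
apply/lee_addgt0Pr => e e0.
have [U [oU KU Ue]] := compact_contentP K1 (divr_gt0 e0 (ltr0n R 2)).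
have [V [oV KV Ve]] := compact_contentP K2 (divr_gt0 e0 (ltr0n R 2)).
rewrite [e]splitr EFinD addeACA; apply: le_trans (leeD Ue Ve).
apply: le_trans (compact_content_le (openU oU oV) (setUSS KU KV)) _.
by rewrite lee_fin p_sub//; exact: omeas.
Qed.

(** Metric spaces are normal: disjoint compact sets have disjoint open neighbourhoods U and V, and
    inside any open G around the union the sets [G & U] and [G & V] share out the mass of G. *)
Let compact_contentU_disj K1 K2 : compact K1 -> compact K2 -> K1 `&` K2 = set0 ->
  compact_content K1 + compact_content K2 <= compact_content (K1 `|` K2).
Proof.
move=> cK1 cK2 K120.
have /(@normal_openP R)/(_ K1 K2)[|||] := @pseudometric_normal R W => //.
- exact: compact_closed_polish.
- exact: compact_closed_polish.
move=> U [V [oU oV KU KV UV0]].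
apply: le_ereal_inf_tmp => _ [G [oG KG] <-].
move: KG; rewrite subUset => -[KG1 KG2].
have oGU : open (G `&` U) by exact: openI.
have oGV : open (G `&` V) by exact: openI.
apply: (@le_trans _ _ (p (G `&` U) + p (G `&` V))%:E).
  by rewrite EFinD leeD// compact_content_le// subsetI.
rewrite lee_fin -pU; [|exact: omeas..|].
  apply: p_le; rewrite -?setIUr; last exact: subIsetl.
    by apply: omeas; apply: openI => //; exact: openU.
  exact: omeas.
by rewrite setIACA UV0 setI0.
Qed.

Let open_content_le U : open U -> open_content U <= (p U)%:E.
Proof. by move=> oU; apply: ge_ereal_sup => _ [K [_ KU] <-]; exact: compact_content_le. Qed.

Let compact_le_open_content K U : compact K -> K `<=` U -> compact_content K <= open_content U.
Proof. by move=> cK KU; apply: ereal_sup_ubound; exists K. Qed.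

Let open_content_ge0 U : 0 <= open_content U.
Proof. by rewrite (le_trans (compact_content_ge0 set0))// compact_le_open_content//; exact: compact0. Qed.

Let le_open_content U V : U `<=` V -> open_content U <= open_content V.
Proof.
move=> UV; apply: ge_ereal_sup => _ [K [cK KU] <-]; apply: compact_le_open_content => //.
exact: subset_trans UV.
Qed.

(** [K \ U] and [K \ V] are disjoint closed sets; cutting disjoint open neighbourhoods of them out
    of K leaves the two pieces. This reduces subadditivity on open sets to subadditivity on compact
    ones. *)
Let compact_split K U V : compact K -> open U -> open V -> K `<=` U `|` V ->
  exists K1 K2 : set W, [/\ compact K1, compact K2, K1 `<=` U, K2 `<=` V & K = K1 `|` K2].
Proof.
move=> cK oU oV KUV; have cK' := compact_closed_polish cK.
have /(@normal_openP R)/(_ (K `\` U) (K `\` V))[|||] := @pseudometric_normal R W.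
- by apply: closedI => //; exact: open_closedC.
- by apply: closedI => //; exact: open_closedC.
- by apply/seteqP; split=> x //= [[/KUV[]]] ? ? [].
move=> G1 [G2 [oO1 oO2 KO1 KO2 G120]].
exists (K `\` G1), (K `\` G2); split.
- apply: (subclosed_compact _ cK (@subDsetl _ _ _)).
  by apply: closedI => //; exact: open_closedC.
- apply: (subclosed_compact _ cK (@subDsetl _ _ _)).
  by apply: closedI => //; exact: open_closedC.
- by move=> x [Kx O1x]; apply: contrapT => Ux; apply: O1x; exact: KO1.
- by move=> x [Kx O2x]; apply: contrapT => Vx; apply: O2x; exact: KO2.
- by rewrite -setDIr G120 setD0.
Qed.

Let open_contentU U V : open U -> open V -> open_content (U `|` V) <= open_content U + open_content V.
Proof.
move=> oU oV; apply: ge_ereal_sup => _ [K [cK KUV] <-].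
have [K1 [K2 [cK1 cK2 K1U K2V ->]]] := compact_split cK oU oV KUV.
by apply: le_trans (compact_contentU _ _) _; apply: leeD; exact: compact_le_open_content.
Qed.

Let open_content_bigsetU (U : nat -> set W) n : (forall i, open (U i)) ->
  open_content (\big[setU/set0]_(i < n) U i) <= \sum_(i < n) open_content (U i).
Proof.
move=> oU; elim: n => [|n ih].
  rewrite !big_ord0 (le_trans (open_content_le _))//; first exact: open0.
  by rewrite p_set0.
rewrite !big_ord_recr/=; apply: le_trans (leeD2r _ ih); apply: open_contentU => //.
by rewrite -bigcup_mkord; apply: bigcup_open => i _.
Qed.

Let open_content_bigcup (U : nat -> set W) : (forall i, open (U i)) ->
  open_content (\bigcup_i U i) <= \sum_(i <oo) open_content (U i).
Proof.
move=> oU; apply: ge_ereal_sup => _ [K [+ KU] <-] => cK.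
have := cK; rewrite compact_cover => /(_ _ setT U)[//|//|D _ KD].
(* The finite subcover has an arbitrary index set; it is enlarged to an initial segment so that
   partial sums of the series apply. *)
pose n := (\max_(i <- finmap.enum_fset D) i).+1.
have KDn : K `<=` \big[setU/set0]_(i < n) U i.
  apply: (subset_trans KD) => x [i iD Uix]; rewrite -bigcup_mkord.
  by exists i => //=; rewrite /n ltnS; apply: leq_bigmax_seq.
apply: le_trans (compact_le_open_content cK KDn) _; apply: le_trans (open_content_bigsetU _ oU) _.
by rewrite -(big_mkord xpredT (fun i => open_content (U i))) nneseries_lim_ge.
Qed.

Let outer_content_open U : open U -> outer_content U = open_content U.
Proof.
move=> oU; apply/eqP; rewrite eq_le ereal_inf_lbound/=; last by exists U => //; split.
by apply: le_ereal_inf_tmp => _ [V [oV UV] <-]; exact: le_open_content.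
Qed.

Let outer_content_le A U : open U -> A `<=` U -> outer_content A <= open_content U.
Proof. by move=> oU AU; apply: ereal_inf_lbound; exists U. Qed.

Let outer_content_ge0 A : 0 <= outer_content A.
Proof. by apply: le_ereal_inf_tmp => _ [U _ <-]. Qed.

Let le_outer_content : {homo outer_content : A B / A `<=` B >-> A <= B}.
Proof.
move=> A B AB; apply: le_ereal_inf_tmp => _ [U [oU BU] <-].
by apply: outer_content_le => //; exact: subset_trans BU.
Qed.

Let outer_content0 : outer_content set0 = 0.
Proof.
apply/eqP; rewrite eq_le outer_content_ge0 andbT (le_trans (outer_content_le open0 _))//.
by rewrite (le_trans (open_content_le open0))// p_set0.
Qed.

Let outer_content_fin A : outer_content A \is a fin_num.
Proof.
rewrite ge0_fin_numE//; apply: le_lt_trans (ltry 1).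
by rewrite (le_trans (outer_content_le openT _))// -pT open_content_le//; exact: openT.
Qed.

Let outer_content_sigma_subadditive : sigma_subadditive outer_content.
Proof.
move=> A; apply/lee_addgt0Pr => e e0.
rewrite (le_trans _ (epsilon_trick _ _ (ltW e0)))//.
have ex n : exists U, [/\ open U, A n `<=` U &
    open_content U <= outer_content (A n) + (e / (2 ^ n.+1)%:R)%:E].
  have en : (0 < e / (2 ^ n.+1)%:R)%R by rewrite divr_gt0// ltr0n expn_gt0.
  have [_ [U [oU AU] <-] /ltW] := lb_ereal_inf_adherent en (outer_content_fin (A n)).
  by exists U.
pose U n := sval (cid (ex n)).
have UP n : [/\ open (U n), A n `<=` U n &
    open_content (U n) <= outer_content (A n) + (e / (2 ^ n.+1)%:R)%:E] := svalP (cid (ex n)).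
apply: (@le_trans _ _ (open_content (\bigcup_i U i))).
  apply: outer_content_le; first by apply: bigcup_open => i _; have [] := UP i.
  by apply: subset_bigcup => i _; have [] := UP i.
apply: (le_trans (open_content_bigcup _)); first by move=> i; have [] := UP i.
by apply: lee_nneseries => // i _; have [] := UP i.
Qed.

HB.instance Definition _ := isOuterMeasure.Build R W outer_content
  outer_content0 outer_content_ge0 le_outer_content outer_content_sigma_subadditive.

(** It suffices to test on an open V containing A. Take a compact K in [V & U]; then [V \ K] is open
    and contains [V \ U], and any compact L in it is disjoint from K, so the contents of K and L add
    up inside V. Taking the supremum over L and then over K gives the claim. *)
Let open_caratheodory U : open U -> outer_content.-caratheodory U.
Proof.
move=> oU; apply: le_caratheodory_measurable => A.
apply: le_ereal_inf_tmp => _ [V [oV AV] <-].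
have oVU : open (V `&` U) by exact: openI.
apply: (@le_trans _ _ (open_content (V `&` U) + outer_content (V `\` U))).
  by apply: leeD; [apply: outer_content_le => //; exact: setSI|apply: le_outer_content; exact: setSI].
rewrite -leeBrDr; last exact: outer_content_fin.
apply: ge_ereal_sup => _ [K [cK KVU] <-].
move: KVU; rewrite subsetI => -[KV KU].
rewrite leeBrDr; last exact: outer_content_fin.
have oVK : open (V `\` K).
  by apply: openI => //; apply: closed_openC; exact: compact_closed_polish.
apply: (@le_trans _ _ (compact_content K + open_content (V `\` K))).
  by rewrite leeD2l// outer_content_le// => x [Vx Ux]; split => // /KU.
rewrite addeC -leeBrDr//; apply: ge_ereal_sup => _ [L [cL LVK] <-].
rewrite leeBrDr// addeC (le_trans (compact_contentU_disj cK cL _))//.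
  by apply/seteqP; split=> x //= [Kx /LVK[]].
apply: compact_le_open_content; first exact: compactU.
by rewrite subUset; split=> // x /LVK[].
Qed.

Let outer_content_meas (A : set W) : measurable A -> outer_content.-caratheodory A.
Proof.
rewrite polish_borel.
have : <<s @open W >> `<=` outer_content.-cara.-measurable.
  apply: smallest_sub; first exact: sigma_algebra_measurable.
  exact: open_caratheodory.
exact.
Qed.

Definition content_measure (A : set W) : \bar R := outer_content A.

Let cm_sigma : semi_sigma_additive content_measure.
Proof.
move=> F mF tF mbF.
apply: (@caratheodory_measure_sigma_additive R W outer_content) => //.
- by move=> i; exact: outer_content_meas.
- exact: outer_content_meas.
Qed.

HB.instance Definition _ := isMeasure.Build _ _ _ content_measure
  outer_content0 outer_content_ge0 cm_sigma.

Let cmT : content_measure setT = 1.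
Proof.
rewrite /content_measure outer_content_open; last exact: openT.
apply/eqP; rewrite eq_le (le_trans (open_content_le openT)) ?pT//=.
apply/lee_addgt0Pr => e e0; have [K cK Ke] := ptight e0.
rewrite -leeBlDr//; apply: le_trans (compact_le_open_content cK (@subsetT _ _)).
apply: le_ereal_inf_tmp => _ [U [oU KU] <-].
rewrite -EFinB lee_fin (le_trans Ke)// p_le//; last exact: omeas.
exact: compact_measurable_polish.
Qed.

HB.instance Definition _ := Measure_isProbability.Build _ _ _ content_measure cmT.

(** This is the open half of a portmanteau statement. The closed half follows by complements, since
    both masses are 1. *)
Lemma content_probability :
  exists m : probability W R, forall U, open U -> m U <= (p U)%:E.
Proof.
exists content_measure => U oU.
by rewrite /= /content_measure outer_content_open// open_content_le.
Qed.

End content_measure.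

Section tightness.
Context {R : realType} {d} (W : polishType R d).

(** An ultrafilter on K contains one of any finitely many sets that cover K, hence contains
    arbitrarily small balls; it is Cauchy and converges by completeness. *)
Lemma totally_bounded_compact (K : set W) : closed K ->
  (forall e : R, (0 < e)%R ->
    exists s : nat -> W, exists N, K `<=` \bigcup_(i < N) closed_ball (s i) e) ->
  compact K.
Proof.
move=> cK tK; rewrite compact_ultra => F UF FK.
have cF : cauchy F.
  apply/cauchy_ballP => e e0.
  have [s [N KN]] := tK _ (divr_gt0 e0 (ltr0n R 4)).
  have [i Fi] : exists i, F (closed_ball (s i) (e / 4)).
    apply: contrapT => /forallNP nF.
    have : F (\bigcap_(i < N) ~` closed_ball (s i) (e / 4)).
      rewrite bigcap_mkord; apply: (big_ind F) => [||i _]; [exact: filterT|exact: filterI|].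
      by have [|//] := in_ultra_setVsetC (closed_ball (s i) (e / 4)) UF; move/nF.
    move/(filterI FK) => /filter_ex[x [/KN[i iN si]]] /(_ i iN); exact.
  exists (closed_ball (s i) (e / 4), closed_ball (s i) (e / 4)) => //=.
  (* A closed ball is the closure of the open one, so the radius is doubled once to enter an open
     ball and once more by the triangle inequality; hence e / 4. *)
  have sub x : closed_ball (s i) (e / 4) x -> ball (s i) (e / 2) x.
    move=> /(_ (ball x (e / 4)))[|y [siy xy]].
      by apply: nbhsx_ballx; rewrite divr_gt0.
    have -> : (e / 2 = e / 4 + e / 4)%R by lra.
    by apply: ball_triangle siy _; exact: ball_sym.
  by move=> [x y] [/sub sx /sub sy]; rewrite /= [e]splitr; apply: ball_triangle sy; exact: ball_sym.
have /cvg_ex[l Fl] : cvg F by apply: cauchy_cvg cF.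
exists l; split => //=.
apply: cK => B /Fl FB; have /filter_ex[x [Kx Bx]] : F (K `&` B) by exact: filterI.
by exists x.
Qed.

(** Finitely many closed balls of radius 1/(j+1) around a dense sequence lose mass at most
    e/2^(j+1). The intersection over j is closed and totally bounded, and loses at most e. *)
Lemma ulam (P : probability W R) (e : R) : (0 < e)%R ->
  exists2 K, compact K & (1 - e)%:E <= P K.
Proof.
move=> e0; have [S /pcard_surjP[s sS] dS] := @polish_separable R d W.
pose B j n : set W := \bigcup_(i < n) closed_ball (s i) (j.+1%:R^-1 : R).
have cB j n : closed (B j n).
  by rewrite /B bigcup_mkord; apply: closed_bigsetU => i _; exact: closed_ball_closed.
have mB j n : measurable (B j n) by exact: closed_measurable_polish.
have UB j : \bigcup_n B j n = [set: W].
  apply/seteqP; split=> // x _.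
  have j0 : (0 < j.+1%:R^-1 :> R)%R by rewrite invr_gt0.
  have [y [xy]] : (ball x j.+1%:R^-1)° `&` S !=set0.
    by apply: dS; [exists x; exact: nbhsx_ballx|exact: open_interior].
  move=> /sS[i _ iy]; exists i.+1 => //; exists i => //=; apply: subset_closed_ball; apply: ball_sym; rewrite iy.
  exact: interior_subset.
have ex j : exists n, P (~` B j n) <= (e / (2 ^ j.+1)%:R)%:E.
  have ndB : nondecreasing_seq (B j).
    by move=> m n mn; apply/subsetPset => x [i /= im ix]; exists i => //=; exact: leq_trans mn.
  have cv : P (B j n) @[n --> \oo] --> 1.
    rewrite -(probability_setT P) -(UB j); apply: nondecreasing_cvg_mu => //.
    exact: bigcup_measurable.
  have ej : (0 < e / (2 ^ j.+1)%:R)%R by rewrite divr_gt0// ltr0n expn_gt0.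
  have /(_ _)/[!near_simpl] := cv [set x | (1 - e / (2 ^ j.+1)%:R)%:E < x].
  case.
    apply: open_nbhs_nbhs; split; first exact: open_ereal_gt_ereal.
    by rewrite /= lte_fin ltrBlDr ltrDl.
  move=> N _ /(_ N (leqnn _)) /= PN; exists N.
  rewrite probability_setC// leeBlDr ?fin_num_measure//.
  have -> : 1 = (e / (2 ^ j.+1)%:R)%:E + (1 - e / (2 ^ j.+1)%:R)%:E.
    by rewrite -EFinD addrC subrK.
  by rewrite leeD2l// ltW.
pose N j := sval (cid (ex j)); pose K := \bigcap_j B j (N j).
have mK : measurable K by exact: bigcapT_measurable.
have cK : closed K by apply: closed_bigI => i _.
exists K.
  apply: totally_bounded_compact => // r r0.
  exists s, (N (Num.truncn r^-1)) => x /(_ (Num.truncn r^-1) I).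
  move=> -[i iN ix]; exists i => //.
  apply: le_closed_ball ix; rewrite invf_ple ?posrE//; apply: ltW.
  exact: truncnS_gt.
have : P (~` K) <= e%:E.
  rewrite setC_bigcap.
  apply: (@le_trans _ _ (\sum_(j <oo) P (~` B j (N j)))).
    apply: measure_sigma_subadditive => //.
      by move=> i; exact: measurableC.
    by apply: bigcupT_measurable => i; exact: measurableC.
  rewrite (@le_trans _ _ (\sum_(j <oo) (e / (2 ^ j.+1)%:R)%:E))//.
    by apply: lee_nneseries => // j _; exact: (svalP (cid (ex j))).
  have := @epsilon_trick R (fun=> 0) e xpredT (fun=> lexx _) (ltW e0).
  by rewrite [X in _ <= X + _]eseries0// add0e; under eq_eseriesr do rewrite add0e.
rewrite probability_setC// leeBlDr ?fin_num_measure// => h.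
by rewrite EFinB leeBlDl.
Qed.

End tightness.

Lemma ultra_compact_cvg (T : topologicalType) (I : Type) (F : set_system I)
    (f : I -> T) (K : set T) : UltraFilter F -> compact K -> (forall i, K (f i)) ->
  exists2 x, K x & f @ F --> x.
Proof.
move=> UF cK Kf.
have [x [Kx clx]] : K `&` cluster (f @ F) !=set0.
  by apply: cK; apply: nearW.
exists x => // B nB.
have [//|FB] := in_ultra_setVsetC (f @^-1` B) UF.
by have [y []] := clx (~` B) B FB nB.
Qed.

Section ultralimit.
Context {R : realType} {d} (W : polishType R d) (P : nat -> probability W R).
Context (F : set_system nat) {UF : UltraFilter F}.

Definition ulim (A : set W) : R := lim (fine (P n A) @[n --> F]).

Lemma ulim_cvg (A : set W) : measurable A -> fine (P n A) @[n --> F] --> ulim A.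
Proof.
move=> mA.
have [|x _ fx] := @ultra_compact_cvg _ _ F (fun n => fine (P n A)) [set` `[0%R, 1%R]] UF (@segment_compact _ 0%R 1%R).
  move=> n; rewrite /= in_itv/= fine_ge0//= -lee_fin fineK ?fin_num_measure//.
  exact: probability_le1.
by rewrite /ulim (cvg_lim _ fx).
Qed.

Lemma ulim_eq (A : set W) (l : R) : measurable A ->
  fine (P n A) @[n --> F] --> l -> ulim A = l.
Proof. by move=> mA; apply: cvg_lim. Qed.

Lemma ulim_ge0 (A : set W) : measurable A -> (0 <= ulim A)%R.
Proof.
move=> mA; apply: (cvgr_to_ge (ulim_cvg mA)); apply: nearW => n; exact: fine_ge0.
Qed.

Lemma ulim_le (A B : set W) : measurable A -> measurable B -> A `<=` B ->
  (ulim A <= ulim B)%R.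
Proof.
move=> mA mB AB; apply: (ler_cvg_to (ulim_cvg mA) (ulim_cvg mB)).
by apply: nearW => n; rewrite fine_le ?fin_num_measure// le_measure ?inE.
Qed.

Lemma ulimU (A B : set W) : measurable A -> measurable B -> A `&` B = set0 ->
  ulim (A `|` B) = (ulim A + ulim B)%R.
Proof.
move=> mA mB AB; apply: ulim_eq; first exact: measurableU.
rewrite [X in X @ _ --> _](_ : _ = fun n => (fine (P n A) + fine (P n B))%R).
  by apply: cvgD; exact: ulim_cvg.
by apply/funext => n; rewrite measureU// fineD ?fin_num_measure.
Qed.

Lemma ulimT : ulim setT = 1%R.
Proof.
apply: ulim_eq => //; under eq_fun do rewrite probability_setT.
exact: cvg_cst.
Qed.

Lemma ulimC (A : set W) : measurable A -> ulim (~` A) = (1 - ulim A)%R.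
Proof.
move=> mA; rewrite -ulimT -(setUv A) ulimU ?setICr//; last exact: measurableC.
by rewrite addrAC subrr add0r.
Qed.

(** A form of Prokhorov's theorem without subsequences: along an ultrafilter the masses of all
    measurable sets converge at once, but only to a finitely additive limit. Tightness passes to
    that limit because K does not depend on n. *)
Lemma ulim_measure :
  (forall e : R, (0 < e)%R ->
    exists2 K, compact K & \forall n \near F, (1 - e)%:E <= P n K) ->
  exists m : probability W R,
    (forall U, open U -> m U <= (ulim U)%:E) /\
    (forall C, closed C -> (ulim C)%:E <= m C).
Proof.
move=> tP.
have [||||m mP] := @content_probability R d W ulim.
- exact: ulim_ge0.
- exact: ulimU.
- exact: ulimT.
- move=> e /tP[K cK PK]; exists K => //.
  have mK := compact_measurable_polish cK.
  apply: (cvgr_to_ge (ulim_cvg mK)).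
  by apply: filterS PK => n; rewrite -lee_fin fineK ?fin_num_measure.
exists m; split => // C cC; have mC := closed_measurable_polish cC.
have := mP (~` C) (closed_openC cC).
rewrite ulimC// probability_setC// EFinB leeBlDr ?fin_num_measure//.
rewrite -addeA -[leLHS]adde0 leeD2lE// addeC -leeBlDr// sub0e.
by rewrite -?EFinN opprK.
Qed.

End ultralimit.

(** * Identification of measures from inequalities on open sets *)

Section measure_comparison.
Context {R : realType}.

(** [F k] is the closure of the set of points whose ball of radius 1/(k+1) lies in U. That the
    interiors still exhaust U lets a bound valid on open sets be followed by one valid on closed
    sets. *)
Lemma open_inner_approx d (W : polishType R d) (U : set W) : open U ->
  exists F : nat -> set W, [/\ forall k, closed (F k), forall k, F k `<=` U,
    {homo F : m n / (m <= n)%N >-> m `<=` n} & \bigcup_k (F k)° = U].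
Proof.
move=> oU.
pose A k := [set x : W | ball x (k.+1%:R^-1 : R) `<=` U].
have FU k : closure (A k) `<=` U.
  move=> y /(_ (ball y (k.+1%:R^-1 : R))); case.
    by apply: nbhsx_ballx; rewrite invr_gt0.
  by move=> x [Ax yx]; apply: Ax; exact: ball_sym.
exists (fun k => closure (A k)); split=> //.
- by move=> k; exact: closed_closure.
- move=> m n mn; apply: closureS => x; apply: subset_trans.
  by apply: le_ball; rewrite lef_pV2 ?posrE// ler_nat.
apply/seteqP; split=> [x [k _ /interior_subset]|x Ux]; first exact: FU.
have : nbhs x U by exact: open_nbhs_nbhs.
move=> /nbhs_ballP[e /= e0 eU].
exists (Num.truncn (2 / e)) => //.
set r : R := ((Num.truncn (2 / e)).+1%:R^-1)%R.
have r0 : (0 < r)%R by rewrite invr_gt0.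
have re : (r + r <= e)%R.
  rewrite -mulr2n -mulr_natl ler_pdivrMr// mulrC -ler_pdivrMr//.
  by apply: ltW; exact: truncnS_gt.
apply/nbhs_ballP; exists r => //= y xy; apply: subset_closure => z yz.
by apply: eU; apply: le_ball re _ _; exact: ball_triangle xy yz.
Qed.

(** As both masses are 1, complements reverse the inequality on closed sets; open sets are
    increasing unions of closed ones, so equality holds on the pi-system of open sets. *)
Lemma le_open_measure_eq d (W : polishType R d) (m a : probability W R) :
  (forall U, open U -> m U <= a U) -> m ≡μ a.
Proof.
move=> ma.
have cma C : closed C -> a C <= m C.
  move=> cC; have mC := closed_measurable_polish cC.
  have := ma (~` C) (closed_openC cC).
  rewrite !probability_setC// -(@fineK _ (m C)) ?fin_num_measure//.
  by rewrite -(@fineK _ (a C)) ?fin_num_measure// -!EFinB !lee_fin; lra.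
have oma U : open U -> m U = a U.
  move=> oU; apply/eqP; rewrite eq_le ma//=.
  have [F [cF FU ndF FE]] := open_inner_approx oU.
  have UF : \bigcup_k F k = U.
    apply/seteqP; split=> [x [k _]|x]; first exact: FU.
    by rewrite -{1}FE => -[k _ /interior_subset]; exists k.
  have mF k : measurable (F k) by exact: closed_measurable_polish.
  have ndF' : nondecreasing_seq F by move=> i j ij; apply/subsetPset; exact: ndF.
  have mU := open_measurable_polish oU.
  have cv (q : probability W R) : q (F k) @[k --> \oo] --> q U.
    by rewrite -UF; apply: nondecreasing_cvg_mu => //; rewrite UF.
  by apply: lee_cvg_to (cv a) (cv m) _; apply: nearW => k; exact: cma.
apply: (measure_unique (@open W) (fun=> setT)).
- exact: polish_borel.
- by move=> A B; exact: openI.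
- by move=> _; exact: openT.
- by rewrite bigcup_const.
- exact: oma.
- by move=> _; apply: le_lt_trans (ltry 1); rewrite probability_le1.
Qed.

Context {dY dZ} (Y : polishType R dY) (Z : polishType R dZ).

Let rect : set (set (Y * Z)) := [set A `*` B | A in @open Y & B in @open Z].

Let rect_gen : @measurable _ (Y * Z)%type = <<s rect >>.
Proof.
rewrite eqEsubset; split; last first.
  apply: smallest_sub; first exact: sigma_algebra_measurable.
  move=> _ [A oA] [B oB] <-.
  by apply: measurableX; exact: open_measurable_polish.
apply: smallest_sub; first exact: smallest_sigma_algebra.
have H d (T : polishType R d) (f : Y * Z -> T) (A : set T) :
    (forall O, open O -> rect (f @^-1` O)) -> measurable A -> <<s rect >> (f @^-1` A).
  move=> cf; rewrite polish_borel => mA; rewrite -[_ @^-1` _]setTI.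
  apply: (@measurability _ _ (g_sigma_algebraType rect) (g_sigma_algebraType (@open T)) setT f (@open T)) => //.
  by move=> _ [B oB <-]; rewrite setTI; apply: sub_gen_smallest; exact: cf.
move=> _ [[A mA <-]|[A mA <-]]; rewrite setTI.
  apply: H mA => U oU; exists U => //; exists setT; first exact: openT.
  by apply/seteqP; split=> -[y z] //= [].
apply: H mA => U oU; exists setT; first exact: openT.
by exists U => //; apply/seteqP; split=> -[y z] //= [].
Qed.

(** Taking U or V to be the whole space identifies the marginals. Approximating [~] V[by decreasing
    open sets extends the bound to U times]~[V]. The two bounds then add up to a(U), which is the
    actual mass of the two pieces together, so both are equalities. *)
Lemma le_open_prod_measure_eq (m : probability (Y * Z)%type R)
    (a : probability Y R) (b : probability Z R) :
  (forall U V, open U -> open V -> m (U `*` V) <= a U * b V) ->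
  m ≡μ (a \x b).
Proof.
move=> mab.
have omeas d (T : polishType R d) := @open_measurable_polish R d T.
have ma : distribution m projfst ≡μ a.
  apply: le_open_measure_eq => U oU.
  have := mab U setT oU openT; rewrite probability_setT mule1.
  suff -> : U `*` [set: Z] = @projfst _ _ Y Z @^-1` U by [].
  by apply/seteqP; split=> -[y z] //= [].
have mb : distribution m projsnd ≡μ b.
  apply: le_open_measure_eq => V oV.
  have := mab setT V openT oV; rewrite probability_setT mul1e.
  suff -> : [set: Y] `*` V = @projsnd _ _ Y Z @^-1` V by [].
  by apply/seteqP; split=> -[y z] //= [].
have mabC U V : open U -> open V -> m (U `*` ~` V) <= a U * b (~` V).
  move=> oU oV.
  have [F [cF FV ndF FE]] := open_inner_approx oV.
  have VF : \bigcup_k F k = V.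
    apply/seteqP; split=> [x [k _]|x]; first exact: FV.
    by rewrite -{1}FE => -[k _ /interior_subset]; exists k.
  have mF k : measurable (F k) by exact: closed_measurable_polish.
  have mCF k : measurable (~` F k) by exact: measurableC.
  have mV := omeas _ _ _ oV.
  have cv : a U * b (~` F k) @[k --> \oo] --> a U * b (~` V).
    apply: cvgeZl; first by rewrite fin_num_measure//; exact: omeas.
    rewrite -VF setC_bigcup; apply: nonincreasing_cvg_mu => //.
    - by rewrite (le_lt_trans (probability_le1 _ _))// ltry.
    - exact: bigcapT_measurable.
    - by move=> i j ij; apply/subsetPset/subsetC; exact: ndF.
  apply: (cvge_to_ge cv); apply: nearW => k.
  have oFk : open (~` F k) by exact: closed_openC.
  apply: le_trans (mab _ _ oU oFk); apply: le_measure; rewrite ?inE.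
  - by apply: measurableX; [exact: omeas|exact: measurableC].
  - by apply: measurableX; exact: omeas.
  - by move=> [y z] [/= Uy Vz]; split => //= /FV.
apply: (measure_unique rect (fun=> setT)).
- exact: rect_gen.
- move=> _ _ [A oA [B oB <-]] [A' oA' [B' oB' <-]].
  exists (A `&` A'); first exact: openI.
  by exists (B `&` B'); [exact: openI|rewrite setXI].
- by move=> _; exists setT; [exact: openT|exists setT; [exact: openT|rewrite setXTT]].
- by rewrite bigcup_const.
- move=> _ [U oU [V oV <-]]; have mU := omeas _ _ _ oU; have mV := omeas _ _ _ oV.
  transitivity (a U * b V); last exact/esym/product_measure1E.
  apply/eqP; rewrite eq_le mab//=.
  have mCV := measurableC mV.
  have E : m (U `*` V) + m (U `*` ~` V) = a U * b V + a U * b (~` V).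
    rewrite -measureU; [|exact: measurableX..|]; last first.
      by apply/seteqP; split=> -[y z] //= [[_ ?] [_]].
    have -> : U `*` V `|` U `*` ~` V = U `*` setT.
      apply/seteqP; split=> -[y z] /=; first by case=> -[].
      by move=> [Uy _]; have [] := EM (V z); [left|right].
    rewrite -ge0_muleDr//.
    rewrite probability_setC// addeC subeK ?fin_num_measure// mule1.
    rewrite -(ma U mU) /distribution /pushforward; congr (m _).
    by apply/seteqP; split=> -[y z] //= [].
  have f1 : m (U `*` ~` V) \is a fin_num by rewrite fin_num_measure//; exact: measurableX.
  rewrite -(leeD2rE _ _ f1) E; apply: leeD2l; exact: mabC.
- by move=> _; apply: le_lt_trans (ltry 1); rewrite probability_le1.
Qed.

End measure_comparison.

Section lsc_integral.
Context {R : realType} {d} (W : polishType R d) (P : nat -> probability W R).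
Context (F : set_system nat) {UF : UltraFilter F} (m : probability W R).
Hypothesis mP : forall U, open U -> m U <= (ulim P F U)%:E.
Context (f : W -> R).
Hypothesis mf : measurable_fun setT f.
Hypothesis f0 : forall x, (0 <= f x)%R.
Hypothesis lscf : forall t, open [set x | (t < f x)%R].

(* Lower Riemann sums of the layer-cake formula; the indicators are those of
   open sets, on which [mP] compares m with the ultralimit. *)
Let stair (e : R) K x : R := (\sum_(k < K) e * \1_[set x | (k.+1%:R * e < f x)%R] x)%R.

Let mO (t : R) : measurable [set x | (t < f x)%R].
Proof. exact: open_measurable_polish. Qed.

Let stair_bounds (e : R) K x : (0 < e)%R ->
  (Num.min (f x) (K%:R * e) - e <= stair e K x <= Num.min (f x) (K%:R * e))%R.
Proof.
move=> e0.
(* The third clause carries the induction: above the top level every step is already present. *)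
suff : (stair e K x <= Num.min (f x) (K%:R * e))%R /\
    (Num.min (f x) (K%:R * e) - e <= stair e K x)%R /\
    ((K%:R * e < f x)%R -> (stair e K x = K%:R * e)%R) by move=> [-> [->]].
elim: K => [|K [ih1 [ih2 ih3]]].
  rewrite /stair big_ord0 mul0r (min_idPr (f0 x)) sub0r oppr_le0 lexx.
  by split=> //; split=> //; exact: ltW.
rewrite /stair big_ord_recr/= -/(stair e K x).
have KS : (K.+1%:R * e = K%:R * e + e)%R by rewrite -natr1 mulrDl mul1r.
rewrite indicE.
move: ih1 ih2 ih3; case: (ltP (K.+1%:R * e)%R (f x)) => [h|h].
  have h' : (K%:R * e < f x)%R by rewrite (lt_trans _ h)// KS ltrDl.
  rewrite mem_set//= => _ _ /(_ h') ->.
  by rewrite mulr1 KS addrK lerDl lexx ltW.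
rewrite memNset/=; last by apply/negP; rewrite -leNgt.
rewrite mulr0 addr0; case: (ltP (K%:R * e)%R (f x)) => [h'|h'].
  move=> _ _ /(_ isT) ->; split; first exact: ltW.
  by split; [rewrite lerBlDr -KS|].
by move=> ? ?.
Qed.

Let stair_ge0 e K x : (0 < e)%R -> (0 <= stair e K x)%R.
Proof. by move=> e0; apply: sumr_ge0 => k _; rewrite mulr_ge0// ltW. Qed.

Let measurable_stair e K : measurable_fun setT (stair e K).
Proof.
by apply: measurable_sum => k; exact: measurable_funM.
Qed.

Let integral_stair (Q : probability W R) e K : (0 < e)%R ->
  \int[Q]_x (stair e K x)%:E =
  (\sum_(k < K) e * fine (Q [set x | (k.+1%:R * e < f x)%R]))%:E.
Proof.
move=> e0; rewrite -sumEFin; under eq_integral do rewrite /stair -sumEFin.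
rewrite ge0_integral_sum//; last 2 first.
- by move=> k; apply/measurable_EFinP; exact: measurable_funM.
- by move=> k x _; rewrite lee_fin mulr_ge0// ltW.
apply: eq_bigr => k _; under eq_integral do rewrite EFinM.
rewrite ge0_integralZl_EFin//; last 2 first.
- by apply/measurable_EFinP; exact: measurable_indic.
- exact: ltW.
by rewrite integral_indic// setIT EFinM fineK ?fin_num_measure.
Qed.

(** A staircase below f is a finite combination of indicators of open sets, so its integral passes
    to the limit in the right direction. Refining the step recovers truncations of f, and monotone
    convergence removes the truncation. *)
Lemma lsc_integral_le (t : R) :
  (forall e : R, (0 < e)%R -> \forall n \near F, \int[P n]_x (f x)%:E <= (t + e)%:E) ->
  \int[m]_x (f x)%:E <= t%:E.
Proof.
move=> Ft.
have st e K : (0 < e)%R -> \int[m]_x (stair e K x)%:E <= t%:E.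
  move=> e0; rewrite integral_stair//.
  apply: (@le_trans _ _ (\sum_(k < K) e * ulim P F [set x | (k.+1%:R * e < f x)%R])%:E).
    rewrite lee_fin; apply: ler_sum => k _; apply: ler_wpM2l; first exact: ltW.
    by rewrite -lee_fin fineK ?fin_num_measure// mP.
  have cv : (\sum_(k < K) e * fine (P n [set x | (k.+1%:R * e < f x)]))%R
      @[n --> F] --> (\sum_(k < K) e * ulim P F [set x | (k.+1%:R * e < f x)])%R.
    apply: cvg_big => [|k _]; first exact: add_continuous.
    by apply: cvgM; [exact: cvg_cst|exact: ulim_cvg].
  rewrite lee_fin; apply/ler_addgt0Pr => r r0.
  apply: (cvgr_to_le cv); apply: filterS (Ft _ r0) => n.
  rewrite -lee_fin -integral_stair//; apply: le_trans.
  apply: ge0_le_integral => //.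
  - by move=> x _; rewrite lee_fin stair_ge0.
  - exact/measurable_EFinP.
  - exact/measurable_EFinP.
  - move=> x _; rewrite lee_fin.
    have /andP[_ /le_trans] := stair_bounds K x e0; apply.
    by rewrite ge_min lexx.
have trunc j : \int[m]_x (Num.min (f x) j%:R)%:E <= t%:E.
  apply/lee_addgt0Pr => e0 e00.
  have [i ie] : exists i : nat, (i.+1%:R^-1 <= e0)%R.
    exists (Num.truncn e0^-1); rewrite invf_ple ?posrE//.
    by apply: ltW; exact: truncnS_gt.
  apply: (@le_trans _ _ (t + i.+1%:R^-1)%:E); last by rewrite -EFinD lee_fin lerD2l.
  have i0 : (0 < i.+1%:R^-1 :> R)%R by rewrite invr_gt0.
  (* Exactly j(i+1) steps of height 1/(i+1) reach the truncation level j, with an error of one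
     step. *)
  apply: (@le_trans _ _ (\int[m]_x ((stair i.+1%:R^-1 (j * i.+1) x)%:E + (i.+1%:R^-1)%:E))).
    apply: ge0_le_integral => //.
    - by move=> x _; rewrite lee_fin le_min f0/=.
    - by apply/measurable_EFinP; exact: measurable_minr.
    - by apply: emeasurable_funD => //; exact/measurable_EFinP.
    - move=> x _; rewrite -EFinD lee_fin.
      have /andP[+ _] := stair_bounds (j * i.+1) x i0.
      by rewrite natrM mulfK// lerBlDr.
  rewrite ge0_integralD//; last 2 first.
  - by move=> x _; rewrite lee_fin stair_ge0.
  - exact/measurable_EFinP.
  rewrite integral_cst//= [X in _ + _ * X](_ : _ = 1); last exact: probability_setT.
  by rewrite mule1 EFinD leeD2r// st.
have cv : \int[m]_x (Num.min (f x) j%:R)%:E @[j --> \oo] --> \int[m]_x (f x)%:E.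
  have -> : \int[m]_x (f x)%:E = \int[m]_x limn (fun j => (Num.min (f x) j%:R)%:E).
    apply: eq_integral => x _; apply/esym/cvg_lim => //.
    apply: cvg_near_cst; exists (Num.truncn (f x)).+1 => // n /= fn.
    congr (_%:E); apply/min_idPl; apply: le_trans (ltW (truncnS_gt _)) _.
    by rewrite ler_nat.
  apply: cvg_monotone_convergence => //.
  - by move=> n; apply/measurable_EFinP; exact: measurable_minr.
  - by move=> n x _; rewrite lee_fin le_min f0/=.
  - by move=> x _ a b ab; rewrite lee_fin le_min ge_min lexx/= ge_min ler_nat ab orbT.
by apply: (cvge_to_le cv); exact: nearW.
Qed.

End lsc_integral.

Lemma probability_ge_setC (R : realType) d (T : measurableType d) (Q : probability T R) (A : set T) (e : R) :
  measurable A -> (1 - e)%:E <= Q A -> Q (~` A) <= e%:E.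
Proof.
move=> mA; rewrite probability_setC// -(@fineK _ (Q A)) ?fin_num_measure//.
by rewrite -EFinB !lee_fin; lra.
Qed.

Lemma probability_setC_le (R : realType) d (T : measurableType d) (Q : probability T R) (A : set T) (e : R) :
  measurable A -> Q (~` A) <= e%:E -> (1 - e)%:E <= Q A.
Proof.
move=> mA; rewrite probability_setC// -(@fineK _ (Q A)) ?fin_num_measure//.
by rewrite -EFinB !lee_fin; lra.
Qed.

(** * Limits of plans *)

Section plan_limit.
Context {R : realType} {dX dY dZ : measure_display}.
Context {X : polishType R dX} {Y : polishType R dY} {Z : polishType R dZ}.
Notation W := (X * Y * Z)%type.

Lemma continuous_projY : continuous (@projY _ _ _ X Y Z).
Proof.
move=> [[x y] z]; rewrite /projY.
apply: (@continuous_comp _ _ _ (fun p : W => p.1) (fun p => p.2)).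
  exact: cvg_fst.
exact: cvg_snd.
Qed.

Lemma continuous_projXZ : continuous (@projXZ _ _ _ X Y Z).
Proof.
move=> p; have c : {for p, continuous (fun p : W => p.1.1)}.
  apply: (@continuous_comp _ _ _ (fun p : W => p.1) (fun p => p.1)).
    by case: p => p z; exact: cvg_fst.
  by case: p => -[x y] z; exact: cvg_fst.
by apply: cvg_pair; [exact: c|case: p {c} => p z; exact: cvg_snd].
Qed.

Lemma continuous_projYZ : continuous (@projYZ _ _ _ X Y Z).
Proof.
move=> p; apply: cvg_pair; first exact: continuous_projY.
by case: p => p z; exact: cvg_snd.
Qed.

Context (rho : probability (X * Z)%type R) (nu : probability Z R).
Context (P : nat -> probability W R).
Hypothesis PXZ : forall n, distribution (P n) projXZ ≡μ rho.
Hypothesis PYZ : forall (U : set Y) (V : set Z), measurable U -> measurable V ->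
  (fine (P n (projYZ @^-1` (U `*` V))) - fine (P n (projY @^-1` U)) * fine (nu V))%R
    @[n --> \oo] --> (0 : R)%R.
Hypothesis tightY : forall e : R, (0 < e)%R ->
  exists2 K : set Y, compact K & \forall n \near \oo, (1 - e)%:E <= P n (projY @^-1` K).

Let mY (A : set Y) : measurable A -> measurable (@projY _ _ _ X Y Z @^-1` A).
Proof. by move=> mA; rewrite -[_ @^-1` _]setTI; exact: measurable_funPT. Qed.

Let mXZ (A : set (X * Z)) : measurable A -> measurable (@projXZ _ _ _ X Y Z @^-1` A).
Proof. by move=> mA; rewrite -[_ @^-1` _]setTI; exact: measurable_funPT. Qed.

Let mYZ (A : set (Y * Z)) : measurable A -> measurable (@projYZ _ _ _ X Y Z @^-1` A).
Proof. by move=> mA; rewrite -[_ @^-1` _]setTI; exact: measurable_funPT. Qed.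

Let PX n A : measurable A ->
  P n (projXZ @^-1` (projfst @^-1` A)) = distribution rho projfst A.
Proof. by move=> mA; apply: PXZ; rewrite -[_ @^-1` _]setTI; exact: measurable_funPT. Qed.

Let PZ n A : measurable A ->
  P n (projXZ @^-1` (projsnd @^-1` A)) = distribution rho projsnd A.
Proof. by move=> mA; apply: PXZ; rewrite -[_ @^-1` _]setTI; exact: measurable_funPT. Qed.

(** The X- and Z-marginals are those of [rho] for every n, so only Y needs a hypothesis; each factor
    may lose e / 3. *)
Let tight (e : R) : (0 < e)%R ->
  exists2 K : set W, compact K & \forall n \near \oo, (1 - e)%:E <= P n K.
Proof.
move=> e0; have e3 : (0 < e / 3)%R by rewrite divr_gt0.
have [K1 cK1 rK1] := ulam (distribution rho projfst) e3.
have [K2 cK2 rK2] := tightY e3.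
have [K3 cK3 rK3] := ulam (distribution rho projsnd) e3.
have mK1 := compact_measurable_polish cK1.
have mK2 := compact_measurable_polish cK2.
have mK3 := compact_measurable_polish cK3.
exists (K1 `*` K2 `*` K3).
  by apply: compact_setX => //; exact: compact_setX.
apply: filterS rK2 => n nK2.
have mK : measurable (K1 `*` K2 `*` K3).
  by apply: measurableX => //; exact: measurableX.
apply: probability_setC_le => //.
have m1 : measurable (@projXZ _ _ _ X Y Z @^-1` (projfst @^-1` (~` K1))).
  by apply: mXZ; rewrite -[_ @^-1` _]setTI; apply: measurable_funPT => //; exact: measurableC.
have m3 : measurable (@projXZ _ _ _ X Y Z @^-1` (projsnd @^-1` (~` K3))).
  by apply: mXZ; rewrite -[_ @^-1` _]setTI; apply: measurable_funPT => //; exact: measurableC.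
have m2 : measurable (@projY _ _ _ X Y Z @^-1` (~` K2)).
  by apply: mY; exact: measurableC.
apply: (@le_trans _ _ (P n (projXZ @^-1` (projfst @^-1` (~` K1)) `|` projY @^-1` (~` K2)
    `|` projXZ @^-1` (projsnd @^-1` (~` K3))))).
  apply: le_measure; rewrite ?inE//.
  - exact: measurableC.
  - by apply: measurableU => //; exact: measurableU.
  - move=> [[x y] z] /= h; rewrite /projXZ /projY /projfst /projsnd/=.
    have [] := EM (K1 x); have [] := EM (K2 y); have [] := EM (K3 z); tauto.
apply: le_trans (measureU2 _ _ _) _ => //; first exact: measurableU.
apply: (@le_trans _ _ ((e / 3)%:E + (e / 3)%:E + (e / 3)%:E)); last first.
  by rewrite -!EFinD lee_fin; lra.
apply: leeD.
  apply: le_trans (measureU2 _ m1 m2) _; apply: leeD.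
    apply: le_trans (probability_ge_setC mK1 rK1); rewrite le_eqVlt; apply/orP; left.
    by apply/eqP/PX; exact: measurableC.
  by rewrite -preimage_setC; apply: probability_ge_setC => //; exact: mY.
apply: le_trans (probability_ge_setC mK3 rK3); rewrite le_eqVlt; apply/orP; left.
by apply/eqP/PZ; exact: measurableC.
Qed.

(** [PYZ] asks for independence in the limit only, and relative to the Y-marginal of each [P n]. It
    thus covers the glued plans, whose marginals approach a fixed mu, as well as minimizing
    sequences, which are exactly independent but whose Y-marginal varies. *)
Lemma plan_limit : exists m : probability W R,
  [/\ distribution m projXZ ≡μ rho,
      distribution m projYZ ≡μ (distribution m projY \x nu),
      (forall mu : probability Y R, (forall B, measurable B ->
        fine (P n (projY @^-1` B)) @[n --> \oo] --> fine (mu B)) ->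
        distribution m projY ≡μ mu) &
      (forall (f : W -> R) (t : R), measurable_fun setT f -> (forall x, 0 <= f x)%R ->
        (forall s, open [set x | (s < f x)%R]) ->
        (forall e : R, (0 < e)%R -> \forall n \near \oo, \int[P n]_x (f x)%:E <= (t + e)%:E) ->
        \int[m]_x (f x)%:E <= t%:E)].
Proof.
have [F [UF Foo]] := ultraFilterLemma (@eventually_filter).
have [|m [om cm]] := @ulim_measure R _ W P F UF.
  by move=> e /tight[K cK PK]; exists K => //; exact: Foo.
exists m; split.
- apply: le_open_measure_eq => O oO; have mO := open_measurable_polish oO.
  apply: le_trans (om _ _) _.
    by move/continuousP : continuous_projXZ; apply.
  rewrite (@ulim_eq _ _ _ _ _ _ _ (fine (rho O))); [|exact: mXZ|].
    by rewrite fineK ?fin_num_measure.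
  under eq_fun do rewrite [P _ _]PXZ//.
  exact: cvg_cst.
- (* The ultralimit of [projY @^-1` U] may exceed its m-measure, so U is
     exhausted by interiors of closed sets, on which the comparison reverses. *)
  apply: le_open_prod_measure_eq => U V oU oV.
  have mV := open_measurable_polish oV.
  have [G [cG GU ndG GE]] := open_inner_approx oU.
  have oG k : open (G k)° by exact: open_interior.
  have moG k := open_measurable_polish (oG k).
  have -> : U `*` V = \bigcup_k ((G k)° `*` V).
    rewrite -{1}GE; apply/seteqP; split=> [[y z] [[k _ /= ky] Vz]|[y z] [k _ [ky Vz]]].
      by exists k.
    by split=> //; exists k.
  have ndGV : nondecreasing_seq (fun k => (G k)° `*` V).
    move=> i j ij; apply/subsetPset => -[y z] [/= Gy Vz]; split=> //=.
    by move: Gy; apply: interiorS; exact: ndG.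
  have mGV k : measurable ((G k)° `*` V) by exact: measurableX.
  have cv : distribution m projYZ ((G k)° `*` V) @[k --> \oo] -->
      distribution m projYZ (\bigcup_k ((G k)° `*` V)).
    apply: nondecreasing_cvg_mu => //; exact: bigcupT_measurable.
  apply: (cvge_to_le cv); apply: nearW => k.
  rewrite {1}/distribution /pushforward.
  apply: le_trans (om _ _) _.
    move/continuousP : continuous_projYZ; apply.
    have -> : (G k)° `*` V = fst @^-1` (G k)° `&` snd @^-1` V by [].
    by apply: openI; [apply: (open_comp _ (oG k)) => p _; exact: cvg_fst
                     |apply: (open_comp _ oV) => p _; exact: cvg_snd].
  have mG : measurable (G k) := closed_measurable_polish (cG k).
  rewrite (@ulim_eq _ _ _ _ _ _ _ (ulim P F (projY @^-1` (G k)°) * fine (nu V))%R); last 2 first.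
  - by apply: mYZ.
  - have c0 : (fine (P n (projYZ @^-1` ((G k)° `*` V))) -
        fine (P n (projY @^-1` (G k)°)) * fine (nu V))%R @[n --> F] --> (0 : R)%R.
      by apply: cvg_trans (PYZ (moG k) mV); exact: cvg_app.
    have c1 : (fine (P n (projY @^-1` (G k)°)) * fine (nu V))%R @[n --> F] -->
        (ulim P F (projY @^-1` (G k)°) * fine (nu V))%R.
      by apply: cvgM; [apply: ulim_cvg; exact: mY|exact: cvg_cst].
    rewrite -[X in _ --> X]add0r [X in X @ _ --> _](_ : _ = fun n =>
      ((fine (P n (projYZ @^-1` ((G k)° `*` V))) -
        fine (P n (projY @^-1` (G k)°)) * fine (nu V)) +
      fine (P n (projY @^-1` (G k)°)) * fine (nu V))%R).
      exact: cvgD.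
    by apply/funext => n; rewrite subrK.
  rewrite EFinM fineK ?fin_num_measure//; apply: lee_pmul => //.
    by rewrite lee_fin ulim_ge0//; exact: mY.
  apply: (@le_trans _ _ (ulim P F (projY @^-1` (G k)))%:E).
    rewrite lee_fin; apply: ulim_le; [exact: mY..|].
    by apply: preimage_subset; exact: interior_subset.
  apply: le_trans (cm _ _) _.
    by apply: preimage_closed (cG k) => p _; exact: continuous_projY.
  rewrite /distribution/pushforward; apply: le_measure; rewrite ?inE.
  - exact: mY.
  - by apply: mY; exact: open_measurable_polish.
  - by apply: preimage_subset; exact: GU.
- move=> mu Pmu; apply: le_open_measure_eq => O oO; have mO := open_measurable_polish oO.
  apply: le_trans (om _ _) _.
    by move/continuousP : continuous_projY; apply.
  rewrite (@ulim_eq _ _ _ _ _ _ _ (fine (mu O))); [|exact: mY|].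
    by rewrite fineK ?fin_num_measure.
  by apply: cvg_trans (Pmu _ mO); apply: cvg_app.
- move=> f t mf f0 lscf ft; apply: (@lsc_integral_le _ _ _ P F UF m) => // e e0.
  by apply: Foo; exact: ft.
Qed.

End plan_limit.

(** * Measurable kernels, conditioning and glueing *)

Section weak_evaluation.
Context {R : realType} {dX dZ} (X : polishType R dX) (Z : measurableType dZ).

Lemma polish_continuous_measurable (f : X -> R) : continuous f -> measurable_fun setT f.
Proof.
move=> /continuousP cf.
apply: (@measurability _ _ _ _ _ _ _ (RGenOInfty.measurableE R)) => _ [_ [r ->] <-].
rewrite setTI; apply: open_measurable_polish; apply: cf; exact: rray_open.
Qed.

Context (kappa : Z -> probability X R).
Hypothesis mkappa : measurable_fun [set: Z] (kappa : Z -> weak_borel X).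

(** Integration against f is one of the maps that define the weak topology, hence Borel. Values in
    [0, 1] make the real and the extended integral agree. *)
Let measurable_integral_bc (f : X -> R) : continuous f -> (forall x, 0 <= f x <= 1)%R ->
  measurable_fun setT (fun z => \int[kappa z]_x (f x)%:E).
Proof.
move=> cf f01.
have bf : exists M, forall x, (`|f x| <= M)%R.
  by exists 1%R => x; have /andP[f0 f1] := f01 x; rewrite ger0_norm.
pose F : bounded_continuous X := exist _ f (conj cf bf).
pose ev (m : weak_borel X) : R := (\int[m]_x (f x))%R.
have mev : measurable_fun [set: weak_borel X] ev.
  apply: (@measurability _ _ _ _ _ _ _ (RGenOInfty.measurableE R)) => _ [_ [r ->] <-].
  rewrite setTI; apply: sub_gen_smallest.
  have cev : continuous (ev : weak_topology X -> R).
    move=> m B nB.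
    have /(_ _ F) h := (@cvg_sup _ _ _ (nbhs (m : weak_topology X)) m _).1 (@cvg_refl _ _).
    apply: (h (ev @^-1` B)).
    exact: (@initial_continuous _ _ (fun m : probability X R => (\int[m]_x (sval F x))%R) m B nB).
  by move/continuousP : cev; apply; exact: rray_open.
apply: (@eq_measurable_fun _ _ _ _ _ (fun z => (ev (kappa z))%:E)) => [z _|].
  rewrite /ev /Rintegral fineK// ge0_fin_numE; last first.
    by apply: integral_ge0 => x _; rewrite lee_fin; have /andP[] := f01 x.
  apply: (@le_lt_trans _ _ (\int[kappa z]_x (cst 1) x)).
    apply: ge0_le_integral => //.
    - by move=> x _; rewrite lee_fin; have /andP[] := f01 x.
    - by apply/measurable_EFinP; exact: polish_continuous_measurable.
    - by move=> x _; rewrite lee_fin; have /andP[] := f01 x.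
  by rewrite integral_cst// mul1e -ge0_fin_numE// fin_num_measure.
by apply/measurable_EFinP; exact: (measurableT_comp mev mkappa).
Qed.

(** Dynkin induction from the open sets: the mass of an open U is the limit of integrals of Urysohn
    functions squeezed between the indicators of [F k] and U. *)
Lemma measurable_weak_evaluation (A : set X) : measurable A ->
  measurable_fun setT (fun z => kappa z A).
Proof.
rewrite polish_borel; move: A.
apply: (@dynkin_induction _ X (@open X)
  [set A | measurable_fun setT (fun z => kappa z A)]).
- exact: polish_borel.
- by move=> A B; exact: openI.
- apply: (@eq_measurable_fun _ _ _ _ _ (cst 1)) => [z _|]; last exact: measurable_cst.
  by rewrite probability_setT.
- move=> U oU.
  have [F [cF FU ndF FE]] := open_inner_approx oU.
  have mF k : measurable (F k) := closed_measurable_polish (cF k).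
  have mU := open_measurable_polish oU.
  have UF : \bigcup_k F k = U.
    apply/seteqP; split=> [x [k _]|x]; first exact: FU.
    by rewrite -{1}FE => -[k _ /interior_subset]; exists k.
  have ex k : exists f : X -> R, [/\ continuous f, range f `<=` `[0%R, 1%R]%classic,
      f @` (~` U) `<=` [set 0%R] & f @` F k `<=` [set 1%R]].
    apply/uniform_separatorP.
    have /(@normal_separatorP R) := @pseudometric_normal R X; apply => //.
    - exact: open_closedC.
    - by apply/seteqP; split=> x //= [+ /FU].
  pose f k := sval (cid (ex k)).
  have fP k : [/\ continuous (f k), range (f k) `<=` `[0%R, 1%R]%classic,
      f k @` (~` U) `<=` [set 0%R] & f k @` F k `<=` [set 1%R]] := svalP (cid (ex k)).
  have f01 k x : (0 <= f k x <= 1)%R.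
    have [_ + _ _] := fP k => /(_ (f k x)); rewrite /= in_itv/=; apply.
    by exists x.
  have cf k : continuous (f k) by have [] := fP k.
  have mf k := polish_continuous_measurable (cf k).
  apply: (@emeasurable_fun_cvg _ _ _ _ (fun k z => \int[kappa z]_x (f k x)%:E)) => //.
    move=> k; exact: measurable_integral_bc.
  move=> z _.
  have cv : kappa z (F k) @[k --> \oo] --> kappa z U.
    rewrite -UF; apply: nondecreasing_cvg_mu => //; first by rewrite UF.
    by move=> i j ij; apply/subsetPset; exact: ndF.
  apply: (@squeeze_cvge _ _ _ _ (fun k => kappa z (F k)) _ (fun=> kappa z U)) => //; last exact: cvg_cst.
  apply: nearW => k; apply/andP; split.
    rewrite -[F k]setIT -integral_indic//; apply: ge0_le_integral => //.
    - by apply/measurable_EFinP; exact: measurable_indic.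
    - exact/measurable_EFinP.
    - move=> x _; rewrite lee_fin indicE; have [Fx|Fx] := pselect (F k x).
        have [_ _ _ /(_ (f k x)) fx] := fP k.
        by rewrite mem_set// (_ : f k x = 1)%R//; apply: fx; exists x.
      by rewrite memNset//; have /andP[] := f01 k x.
  rewrite -[U]setIT -[in leRHS]integral_indic//; apply: ge0_le_integral => //.
  - by move=> x _; rewrite lee_fin; have /andP[] := f01 k x.
  - exact/measurable_EFinP.
  - by apply/measurable_EFinP; exact: measurable_indic.
  - move=> x _; rewrite lee_fin indicE; have [Ux|Ux] := pselect (U x).
      by rewrite mem_set//; have /andP[] := f01 k x.
    have [_ _ /(_ (f k x)) fx _] := fP k.
    by rewrite (_ : f k x = 0)%R ?memNset//; apply: fx; exists x.
- move=> A mA mkA.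
  apply: (@eq_measurable_fun _ _ _ _ _ (fun z => 1 - kappa z A)) => [z _|].
    by rewrite probability_setC.
  exact: emeasurable_funB.
- move=> F mF tF mkF.
  apply: (@emeasurable_fun_cvg _ _ _ _ (fun n z => \sum_(0 <= k < n) kappa z (F k))).
    by move=> n; exact: emeasurable_sum.
  move=> z _; apply: measure_semi_sigma_additive => //; exact: bigcupT_measurable.
Qed.

End weak_evaluation.

Lemma integral_probability_cst {R : realType} d (T : measurableType d)
  (P : probability T R) (a : R) : \int[P]_x a%:E = a%:E.
Proof. by rewrite integral_cst// [X in _ * X](_ : _ = 1) ?mule1//; exact: probability_setT. Qed.

Lemma measure_integral_indic {R : realType} d (T : measurableType d)
  (P : probability T R) (E : set T) : measurable E -> P E = \int[P]_x (\1_E x)%:E.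
Proof. by move=> mE; rewrite integral_indic// setIT. Qed.

Lemma muleI_fin {R : realType} (x y z : \bar R) : x \is a fin_num -> 0 <= x -> x != 0 ->
  x * y = x * z -> y = z.
Proof.
move=> xf x0 xn0 xyz; have {xn0}x0 : 0 < x by rewrite lt_def xn0.
by apply/eqP; rewrite eq_le; apply/andP; split; rewrite -(lee_pmul2l xf x0) xyz.
Qed.

Lemma subprobability_probability {R : realType} d (T : measurableType d)
    (B : giry T R) : B setT = 1 ->
  exists P : probability T R, forall A, P A = B A.
Proof.
move=> BT; exists (mnormalize B (dirac point)) => A.
by rewrite /= /mnormalize/= BT/= onee_eq0/= invr1 mule1.
Qed.

Section conditioning.
Context {R : realType}.

Lemma conditional_probability d (T : measurableType d) (P : probability T R) (A : set T) :
  measurable A -> P A != 0 -> exists Q : probability T R,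
  (forall E, measurable E -> P (E `&` A) = P A * Q E) /\
  (forall f : T -> \bar R, measurable_fun setT f -> (forall x, 0 <= f x) ->
    \int[P]_(x in A) f x = P A * \int[Q]_x f x).
Proof.
move=> mA PA0.
have PAf : P A \is a fin_num by rewrite fin_num_measure.
have [Q QE] : exists Q : probability T R, forall E, P (E `&` A) = P A * Q E.
  exists (mnormalize (mrestr P mA) P) => E.
  rewrite /= /mnormalize /= /mrestr setTI (negbTE PA0)/=.
  rewrite ifF; last by apply/negbTE; rewrite -ltey -ge0_fin_numE.
  rewrite muleCA -[X in _ * (X * _)](@fineK _ (P A))// -EFinM divff ?mule1//.
  by rewrite fine_eq0.
exists Q; split => // f mf f0.
have QA : Q (~` A) = 0.
  have := QE (~` A); rewrite setICl measure0 => /esym/eqP.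
  by rewrite mule_eq0 (negbTE PA0)/= => /eqP.
have k0 : (0 <= fine (P A))%R by rewrite fine_ge0.
have kE : (NngNum k0)%:num%:E = P A by exact: fineK.
rewrite (eq_measure_integral (mscale (NngNum k0) Q)); last first.
  move=> E mE EA; transitivity (P A * Q E); last by congr (_ * _); exact/esym.
  by rewrite -QE; congr (P _); exact/esym/setIidPl.
rewrite ge0_integral_mscale//; last exact: measurable_funTS.
rewrite kE; congr (_ * _).
rewrite [RHS](@ge0_negligible_integral _ _ _ _ _ (~` A))//; last exact: measurableC.
by rewrite setTD setCK.
Qed.

Lemma conditional_law d d' (X : measurableType d) (Y : measurableType d')
    (P : probability (X * Y)%type R) (A : set X) : measurable A ->
  exists k : probability Y R,
  (forall B, measurable B -> P (A `*` B) = P (A `*` setT) * k B) /\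
  (forall h : Y -> \bar R, measurable_fun setT h -> (forall y, 0 <= h y) ->
    \int[P]_(p in A `*` setT) h p.2 = P (A `*` setT) * \int[k]_y h y).
Proof.
move=> mA; have mAT : measurable (A `*` @setT Y) by exact: measurableX.
have [PA0|PA0] := eqVneq (P (A `*` setT)) 0.
  (* Over a null cell both sides vanish, so any law serves. *)
  exists (distribution P projsnd); split=> [B mB|h mh h0]; rewrite PA0 mul0e.
    apply/eqP; rewrite eq_le measure_ge0 andbT -PA0; apply: le_measure; rewrite ?inE//.
      exact: measurableX.
    by move=> [x y] [].
  apply: null_set_integral => //.
  by apply: measurable_funTS; exact: measurableT_comp.
have [Q [QE Qf]] := conditional_probability mAT PA0.
exists (distribution Q projsnd); split=> [B mB|h mh h0].
  rewrite -QE; last by rewrite -[_ @^-1` _]setTI; exact: measurable_funPT.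
  by congr (P _); apply/seteqP; split=> -[x y] /=; rewrite /projsnd/=; tauto.
rewrite Qf//; last exact: measurableT_comp.
by rewrite /distribution ge0_integral_pushforward.
Qed.

End conditioning.

Section glueing.
Context {R : realType} {dV dY dW : measure_display} (V : measurableType dV) (Y : measurableType dY).
Context (W : measurableType dW) (J : finType) (j : V -> J).
Hypothesis mj : forall a, measurable (j @^-1` [set a]).
Context (k : J -> probability Y R) (w : V * Y -> W).
Hypothesis mw : measurable_fun setT w.
Context (r : probability V R).

Lemma sum_indic_fiber (F : J -> \bar R) v :
  F (j v) = \sum_(a : J) (\1_(j @^-1` [set a]) v)%:E * F a.
Proof.
rewrite (bigD1 (j v))//= big1 ?adde0; last first.
  by move=> a ajv; rewrite indicE memNset ?mul0e//= => /esym/eqP; apply/negP.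
by rewrite indicE mem_set// mul1e.
Qed.

Let mwv v : measurable_fun setT (fun y => w (v, y)).
Proof. by apply: (measurableT_comp mw); exact: pair1_measurable. Qed.

Let K (v : V) : giry W R := giry_map (mwv v) (k (j v)).

(** The mass of B under the kernel is a finite sum over the fibres of [j], each term being the
    measure of a section; no condition on the family [k] is needed. *)
Let mK : measurable_fun setT K.
Proof.
apply: measurable_giry_codensity => // B mB.
apply: (@eq_measurable_fun _ _ _ _ _ (fun v => \sum_(a : J)
    (\1_(j @^-1` [set a]) v)%:E * k a (xsection (w @^-1` B) v))) => [v _|].
  rewrite -(sum_indic_fiber (fun a => k a (xsection (w @^-1` B) v))).
  by congr (k _ _); apply/seteqP; split => y; rewrite /xsection/= inE.
apply: emeasurable_sum => a; apply: emeasurable_funM.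
  by apply/measurable_EFinP; exact: measurable_indic.
apply: measurable_fun_xsection; rewrite -[_ @^-1` _]setTI; exact: mw.
Qed.

Lemma glueing : exists P : probability W R,
  forall f : W -> \bar R, measurable_fun setT f -> (forall x, 0 <= f x) ->
  \int[P]_x f x = \int[r]_v \int[k (j v)]_y f (w (v, y)).
Proof.
pose B : giry W R := giry_bind r mK.
have Bf (f : W -> \bar R) : measurable_fun setT f -> (forall x, 0 <= f x) ->
    \int[B]_x f x = \int[r]_v \int[k (j v)]_y f (w (v, y)).
  move=> mf f0; have := giry_int_bind r mK mf f0; rewrite /giry_int => ->.
  apply: eq_integral => v _.
  by have := giry_int_map (mwv v) (k (j v)) mf f0; rewrite /giry_int.
have BT : B setT = 1.
  rewrite -[LHS]mul1e -integral_cst// Bf//.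
  by under eq_integral do rewrite integral_probability_cst; rewrite integral_probability_cst.
have [P PB] := subprobability_probability BT; exists P => f mf f0; rewrite -Bf//.
by apply: eq_measure_integral => A mA _; exact: PB.
Qed.

End glueing.

Section fiber_integral.
Context {R : realType} {dV : measure_display} (V : measurableType dV) (J : finType) (j : V -> J).
Hypothesis mj : forall a, measurable (j @^-1` [set a]).

Lemma integral_fiber (r : probability V R) (A : set V) (f : V -> \bar R) :
  measurable A -> measurable_fun setT f -> (forall v, 0 <= f v) ->
  \int[r]_(v in A) f v = \sum_(a : J) \int[r]_(v in A `&` j @^-1` [set a]) f v.
Proof.
move=> mA mf f0.
have AE : A = \big[setU/set0]_(a <- enum J) (A `&` j @^-1` [set a]).
  apply/seteqP; split=> [v Av|v]; rewrite -bigcup_seq.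
    by exists (j v) => //=; rewrite mem_enum.
  by move=> [a _ []].
rewrite {1}AE ge0_integral_bigsetU//; first by rewrite big_enum.
- by move=> a; exact: measurableI.
- exact: enum_uniq.
- by apply/trivIsetP => a b _ _ ab; apply/seteqP; split=> v //= [[_ ->] [_]]; exact/eqP.
- by apply: measurable_funTS.
Qed.

Lemma integral_fiber_cst (r : probability V R) (A : set V) (F : J -> \bar R) :
  measurable A -> (forall a, 0 <= F a) ->
  \int[r]_(v in A) F (j v) = \sum_(a : J) F a * r (A `&` j @^-1` [set a]).
Proof.
move=> mA F0; rewrite integral_fiber//.
  apply: eq_bigr => a _; rewrite -integral_cst//; last exact: measurableI.
  by apply: eq_integral => v; rewrite inE => -[_ ->].
apply: (@eq_measurable_fun _ _ _ _ _ (fun v => \sum_(a : J) (\1_(j @^-1` [set a]) v)%:E * F a)).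
  by move=> v _; rewrite -sum_indic_fiber.
apply: emeasurable_sum => a; apply: emeasurable_funM => //.
by apply/measurable_EFinP; exact: measurable_indic.
Qed.

End fiber_integral.

(** * Discretization of the conditional laws *)

Section discretization.
Context {R : realType} {dX dY : measure_display}.
Context {X : measurableType dX} {Y : measurableType dY}.
Context (I : finType) (u : X -> I).
Hypothesis mu_fiber : forall a, measurable (u @^-1` [set a]).
Context (h : I -> Y -> R) (Q : R).
Hypothesis mh : forall a, measurable_fun setT (h a).
Hypothesis h0 : forall a y, (0 <= h a y)%R.
Hypothesis hQ : forall a y, (h a y <= Q)%R.
Context (mu : probability Y R) (e : R).
Hypothesis e0 : (0 < e)%R.

Let cell a : set X := u @^-1` [set a].
Let cn (p : X * Y) : R := h (u p.1) p.2.

Let cn0 p : (0 <= cn p)%R. Proof. exact: h0. Qed.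

(** The mesh 1/N is such that an error x/N in each of the [#|I|] cells totals at most e / 2 whenever
    0 <= x <= 1 + Q. This is used with x = Q for costs and with x = 1 for marginals. *)
Let N : nat := (Num.truncn (2 * (#|I|%:R * (1 + Q)) / e)%R).+1.
Let N0 : (0 < N%:R :> R)%R. Proof. by []. Qed.

(** An index is required because nothing bounds Q below when I is empty. *)
Let Q0 : I -> (0 <= Q)%R.
Proof. by move=> a; apply: le_trans (hQ a point). Qed.

Let NI (x : R) : (0 <= x)%R -> (x <= 1 + Q)%R -> (#|I|%:R * (x / N%:R) <= e / 2)%R.
Proof.
move=> x0 xQ; have := ltW (truncnS_gt (2 * (#|I|%:R * (1 + Q)) / e)%R).
rewrite -/N ler_pdivrMr// => NQ.
rewrite mulrA ler_pdivrMr//.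
have : (#|I|%:R * x <= #|I|%:R * (1 + Q))%R by rewrite ler_wpM2l.
by lra.
Qed.

Let G : finType := {ffun I -> 'I_N.+1}.

Definition cell_weight (kap : probability X R) a : R := fine (kap (cell a)).
Local Notation wt := cell_weight.

(** The range includes N since a cell may carry the whole mass, so [inord] never falls back on its
    default. *)
Definition grid (kap : probability X R) : G :=
  [ffun a => inord (Num.truncn (N%:R * wt kap a)%R)].

Let wt01 kap a : (0 <= wt kap a <= 1)%R.
Proof.
rewrite fine_ge0//= -lee_fin fineK ?fin_num_measure//; last exact: mu_fiber.
by apply: probability_le1; exact: mu_fiber.
Qed.

Let grid_truncn kap a : grid kap a = Num.truncn (N%:R * wt kap a)%R :> nat.
Proof.
rewrite ffunE inordK// ltnS -[leqRHS](@natrK R) le_truncn//.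
by rewrite ger_pMr//; have /andP[] := wt01 kap a.
Qed.

Let grid_bounds kap a :
  ((grid kap a)%:R <= N%:R * wt kap a <= (grid kap a)%:R + 1)%R.
Proof.
rewrite grid_truncn natr1; have /andP[w0 _] := wt01 kap a.
have /truncn_itv/andP[-> h1] : (0 <= N%:R * wt kap a)%R by rewrite mulr_ge0.
exact: ltW.
Qed.

(* The couplings with second marginal mu whose cell masses round to g; the upper
   bound is not strict, so that averages of such couplings qualify too. *)
Let Gam (g : G) (gam : probability (X * Y)%type R) :=
  distribution gam projsnd ≡μ mu /\
  forall a, ((g a)%:R <= N%:R * fine (gam (cell a `*` setT)) <= (g a)%:R + 1)%R.

Let mcn : measurable_fun setT (fun p => (cn p)%:E).
Proof.
apply: (@eq_measurable_fun _ _ _ _ _ (fun p : X * Y => \sum_(a : I)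
    (\1_((u \o fst) @^-1` [set a]) p)%:E * (h a p.2)%:E)) => [p _|].
  by rewrite -(sum_indic_fiber (u \o fst) (fun a => (h a p.2)%:E)).
apply: emeasurable_sum => a; apply: emeasurable_funM.
  apply/measurable_EFinP; apply: measurable_indic.
  by rewrite comp_preimage -[_ @^-1` _]setTI; exact: measurable_fst.
by apply/measurable_EFinP; exact: measurableT_comp.
Qed.

Let mfst a : measurable ((u \o @fst X Y) @^-1` [set a]).
Proof. by rewrite comp_preimage -[_ @^-1` _]setTI; exact: measurable_fst. Qed.

Let cn_le_Q (gam : probability (X * Y)%type R) : \int[gam]_p (cn p)%:E <= Q%:E.
Proof.
rewrite -(integral_probability_cst gam Q); apply: ge0_le_integral => //.
- by move=> p _; rewrite lee_fin cn0.
- by move=> p _; rewrite lee_fin; exact: hQ.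
Qed.

Let cn_ge0 (gam : probability (X * Y)%type R) : 0 <= \int[gam]_p (cn p)%:E.
Proof. by apply: integral_ge0 => p _; rewrite lee_fin cn0. Qed.

(** The order of the quantifiers makes the choice total: a grid point that no coupling realises gets
    an arbitrary witness and no claim. Otherwise the infimum is finite because the costs lie in
    [0, Q]. *)
Let near_optimal (g : G) : exists gam', forall gam, Gam g gam ->
  Gam g gam' /\ \int[gam']_p (cn p)%:E <= \int[gam]_p (cn p)%:E + (e / 2)%:E.
Proof.
have [[gam1 G1]|nG] := pselect (exists gam, Gam g gam); last first.
  by exists point => gam Ggam; exfalso; apply: nG; exists gam.
pose S := [set \int[gam]_p (cn p)%:E | gam in Gam g].
have Sfin : ereal_inf S \is a fin_num.
  rewrite ge0_fin_numE.
    apply: le_lt_trans (ltry Q); apply: le_trans (cn_le_Q gam1).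
    by apply: ereal_inf_lbound; exists gam1.
  by apply: le_ereal_inf_tmp => _ [gam _ <-]; exact: cn_ge0.
have e2 : (0 < e / 2)%R by rewrite divr_gt0.
have [_ [gam' G' <-] /ltW le'] := lb_ereal_inf_adherent e2 Sfin.
exists gam' => gam Ggam; split => //; apply: (le_trans le'); apply: leeD2r.
by apply: ereal_inf_lbound; exists gam.
Qed.

Let opt (g : G) : probability (X * Y)%type R := sval (cid (near_optimal g)).
Let optP g gam : Gam g gam ->
  Gam g (opt g) /\ \int[opt g]_p (cn p)%:E <= \int[gam]_p (cn p)%:E + (e / 2)%:E.
Proof. exact: (svalP (cid (near_optimal g))). Qed.

Definition cell_law (g : G) (a : I) : probability Y R :=
  sval (cid (conditional_law (opt g) (mu_fiber a))).
Local Notation k := cell_law.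
Let kP g a :
  (forall B, measurable B -> opt g (cell a `*` B) = opt g (cell a `*` setT) * k g a B) /\
  (forall f : Y -> \bar R, measurable_fun setT f -> (forall y, 0 <= f y) ->
    \int[opt g]_(p in cell a `*` setT) f p.2 =
    opt g (cell a `*` setT) * \int[k g a]_y f y).
Proof. exact: (svalP (cid (conditional_law (opt g) (mu_fiber a)))). Qed.

Definition cell_cost (g : G) (a : I) : R := fine (\int[k g a]_y (h a y)%:E).
Local Notation H := cell_cost.

Let H_E g a : \int[k g a]_y (h a y)%:E = (H g a)%:E.
Proof.
rewrite fineK// ge0_fin_numE; last by apply: integral_ge0 => y _; rewrite lee_fin.
apply: le_lt_trans (ltry Q); rewrite -(integral_probability_cst (k g a) Q).
apply: ge0_le_integral => //.
- by move=> y _; rewrite lee_fin.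
- exact/measurable_EFinP.
- by move=> y _; rewrite lee_fin.
Qed.

Let H0 g a : (0 <= H g a)%R.
Proof. by apply: fine_ge0; apply: integral_ge0 => y _; rewrite lee_fin. Qed.

Let HQ g a : (H g a <= Q)%R.
Proof.
rewrite -lee_fin -H_E -(integral_probability_cst (k g a) Q).
apply: ge0_le_integral => //.
- by move=> y _; rewrite lee_fin.
- exact/measurable_EFinP.
- by move=> y _; rewrite lee_fin.
Qed.

Let mcellT a : measurable (cell a `*` @setT Y).
Proof. by apply: measurableX => //; exact: mu_fiber. Qed.

Let cellT a : cell a `*` setT = (u \o @fst X Y) @^-1` [set a].
Proof. by apply/seteqP; split=> -[x y] //= []. Qed.

Let opt_cost g : \int[opt g]_p (cn p)%:E =
  (\sum_(a : I) fine (opt g (cell a `*` setT)) * H g a)%:E.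
Proof.
rewrite (integral_fiber mfst)//.
rewrite -sumEFin; apply: eq_bigr => a _; rewrite setTI -cellT.
rewrite EFinM fineK ?fin_num_measure// -H_E.
rewrite -(kP g a).2//; last 2 first.
- exact/measurable_EFinP.
- by move=> y; rewrite lee_fin.
by apply: eq_integral => -[x y]; rewrite inE => -[/= <- _].
Qed.

Let opt_marginal g gam B : Gam g gam -> measurable B ->
  fine (mu B) = (\sum_(a : I) fine (opt g (cell a `*` setT)) * fine (k g a B))%R.
Proof.
move=> /optP[[muE _] _] mB.
have mTB : measurable (@setT X `*` B) by exact: measurableX.
have <- : opt g (setT `*` B) = mu B.
  rewrite -muE//; congr (opt g _); apply/seteqP; split=> -[x y] //= [].
  by [].
apply: EFin_inj; rewrite fineK ?fin_num_measure// -sumEFin.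
rewrite -[LHS]mul1e -integral_cst// (integral_fiber mfst)//.
apply: eq_bigr => a _; rewrite EFinM !fineK ?fin_num_measure//.
rewrite integral_cst ?mul1e; last exact: measurableI.
rewrite -(kP g a).1//; congr (opt g _).
by apply/seteqP; split=> -[x y] /=; rewrite /cell/=; tauto.
Qed.

(** The weights are the true masses of [kap]; only the laws come from the grid point. Hence the cost
    of the glued plan is exactly the integral of this quantity. *)
Definition cell_bound (kap : probability X R) : R :=
  (\sum_(a : I) wt kap a * H (grid kap) a)%R.
Local Notation J := cell_bound.

(** The weights w and those of [opt g] lie in the same grid intervals, which costs Q/N per cell and
    e / 2 in all; the other e / 2 pays for near-optimality. The weights are left free because they
    are the masses of [kap] in one use and averages of such masses in the other. *)
Let weighted_cost g gam (w : I -> R) : Gam g gam ->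
  (forall a, (g a)%:R <= N%:R * w a <= (g a)%:R + 1)%R ->
  (\sum_(a : I) w a * H g a)%:E <= \int[gam]_p (cn p)%:E + e%:E.
Proof.
move=> Gg wb; have [[_ ob] oc] := optP Gg.
apply: (@le_trans _ _ ((\int[opt g]_p (cn p)%:E) + (e / 2)%:E)); last first.
  by rewrite [in leRHS](splitr e) EFinD addeA leeD2r.
rewrite opt_cost -EFinD lee_fin -lerBlDl -sumrB.
apply: (@le_trans _ _ (\sum_(a : I) Q / N%:R)%R).
  apply: ler_sum => a _; rewrite -mulrBl.
  apply: (@le_trans _ _ (N%:R^-1 * H g a)%R).
    rewrite ler_wpM2r// -[leRHS]div1r ler_pdivlMr// mulrC mulrBr.
    by have := wb a; have := ob a; lra.
  by rewrite mulrC ler_wpM2r// invr_ge0.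
rewrite sumr_const -[leLHS]mulr_natl.
have [I0|] := pselect (exists a : I, True).
  by have [a _] := I0; apply: NI; [exact: (Q0 a)|rewrite lerDr].
move=> nI; rewrite eq_card0 ?mul0r ?divr_ge0// ?ltW// => a.
by exfalso; apply: nI; exists a.
Qed.

Lemma cell_bound_le (kap : probability X R) (gam : probability (X * Y)%type R) :
  distribution gam projfst ≡μ kap ->
  distribution gam projsnd ≡μ mu -> (J kap)%:E <= \int[gam]_p (cn p)%:E + e%:E.
Proof.
move=> gk gm; apply: weighted_cost; last exact: grid_bounds.
split=> // a; have -> : gam (cell a `*` setT) = kap (cell a).
  rewrite -gk; last exact: mu_fiber.
  by congr (gam _); apply/seteqP; split=> -[x y] //= [].
exact: grid_bounds.
Qed.

Lemma cell_bound_ge0 kap : (0 <= J kap)%R.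
Proof.
by apply: sumr_ge0 => a _; rewrite mulr_ge0//; have /andP[] := wt01 kap a.
Qed.

Section plans.
Context {dZ : measure_display} {Z : measurableType dZ}.
Context (rho : probability (X * Z)%type R) (nu : probability Z R).
Context (kappa : Z -> probability X R).
Hypothesis mkappa : forall A, measurable A -> measurable_fun setT (fun z => kappa z A).
Hypothesis rhoE : forall A B, measurable A -> measurable B ->
  rho (A `*` B) = \int[nu]_(z in B) kappa z A.

Let S (g : G) : set Z := (grid \o kappa) @^-1` [set g].

Let mwt a : measurable_fun setT (fun z => wt (kappa z) a).
Proof.
apply: (@measurableT_comp _ _ _ _ _ _ _ _ (fun z => kappa z (cell a))) => //.
by apply: mkappa; exact: mu_fiber.
Qed.

Let mS g : measurable (S g).
Proof.
have -> : S g = \big[setI/setT]_(a : I)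
    (fun z => N%:R * wt (kappa z) a)%R @^-1` `[(g a)%:R, (g a).+1%:R[%classic.
  apply/seteqP; split=> [z <-|z].
    rewrite -bigcap_seq => a _ /=; rewrite in_itv/= grid_truncn; apply: truncn_itv.
    by rewrite mulr_ge0//; have /andP[] := wt01 (kappa z) a.
  rewrite -bigcap_seq => zg; apply/ffunP => a; apply: val_inj => /=.
  rewrite grid_truncn; apply: truncn_def.
  by have := zg a; rewrite /= in_itv/=; apply; rewrite mem_index_enum.
apply: bigsetI_measurable => a _; rewrite -[_ @^-1` _]setTI.
by apply: measurable_funM.
Qed.

Let rho_bounds g a D : measurable D -> D `<=` S g ->
  ((g a)%:R * fine (nu D) <= N%:R * fine (rho (cell a `*` D)) <=
   ((g a)%:R + 1) * fine (nu D))%R.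
Proof.
move=> mD DS; have mc := mu_fiber a.
have mcD : measurable (cell a `*` D) by exact: measurableX.
have Nk : N%:R%:E * rho (cell a `*` D) = \int[nu]_(z in D) (N%:R%:E * kappa z (cell a)).
  rewrite rhoE// ge0_integralZl_EFin//.
  by apply: measurable_funTS; exact: mkappa.
have kE z : N%:R%:E * kappa z (cell a) = (N%:R * wt (kappa z) a)%:E.
  by rewrite EFinM fineK ?fin_num_measure.
have mNk : measurable_fun D (fun z => N%:R%:E * kappa z (cell a)).
  by apply: measurable_funTS; apply: measurable_funeM; exact: mkappa.
apply/andP; split; rewrite -lee_fin 2!EFinM !fineK ?fin_num_measure// Nk -integral_cst//;
  apply: ge0_le_integral => //.
- by move=> z _; rewrite lee_fin.
- by move=> z Dz; rewrite kE lee_fin -(DS z Dz)/=; have /andP[] := grid_bounds (kappa z) a.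
- by move=> z _; rewrite mule_ge0.
- by move=> z Dz; rewrite kE lee_fin -(DS z Dz)/=; have /andP[] := grid_bounds (kappa z) a.
Qed.

Lemma measurable_cell_bound : measurable_fun setT (fun z => J (kappa z)).
Proof.
apply: measurable_sum => a; apply: measurable_funM => //.
apply/measurable_EFinP.
apply: (@eq_measurable_fun _ _ _ _ _ (fun z => \sum_(g : G)
    (\1_((grid \o kappa) @^-1` [set g]) z)%:E * (H g a)%:E)) => [z _|].
  by rewrite -(sum_indic_fiber (grid \o kappa) (fun g => (H g a)%:E)).
apply: emeasurable_sum => g; apply: emeasurable_funM => //.
apply/measurable_EFinP; apply: measurable_indic; exact: mS.
Qed.

Let mrho g a : measurable (cell a `*` S g).
Proof. by apply: measurableX; [exact: mu_fiber|exact: mS]. Qed.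

Lemma integral_cell_bound : \int[nu]_z (J (kappa z))%:E =
  \sum_(g : G) \sum_(a : I) (H g a)%:E * rho (cell a `*` S g).
Proof.
rewrite (integral_fiber mS)//; last 2 first.
- by apply/measurable_EFinP; exact: measurable_cell_bound.
- by move=> z; rewrite lee_fin cell_bound_ge0.
apply: eq_bigr => g _; rewrite setTI -/(S g); have mSg := mS g.
rewrite (eq_integral (fun z => \sum_(a : I) (H g a)%:E * kappa z (cell a))).
  rewrite ge0_integral_sum//; last 2 first.
  - by move=> a; apply: measurable_funTS; apply: measurable_funeM; apply: mkappa; exact: mu_fiber.
  - by move=> a z _; rewrite mule_ge0// lee_fin.
  apply: eq_bigr => a _; rewrite rhoE//; last exact: mu_fiber.
  rewrite ge0_integralZl_EFin//.
  by apply: measurable_funTS; apply: mkappa; exact: mu_fiber.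
move=> z; rewrite inE => Sz; rewrite /J -sumEFin; apply: eq_bigr => a _.
have -> : grid (kappa z) = g by exact: Sz.
rewrite EFinM muleC; congr (_ * _); rewrite /cell_weight fineK// fin_num_measure//.
exact: mu_fiber.
Qed.

(** Conditioning pi on z in [S g] leaves Y with law mu, because Y and Z are independent under pi.
    The conditioned law of (x, y) is therefore an admissible coupling for g, and [weighted_cost]
    applies to it with its own cell masses. *)
Lemma integral_cell_bound_le (pi : probability (X * Y * Z)%type R) :
  distribution pi projXZ ≡μ rho -> distribution pi projYZ ≡μ (mu \x nu) ->
  \int[nu]_z (J (kappa z))%:E <= \int[pi]_p (cn p.1)%:E + e%:E.
Proof.
move=> piXZ piYZ; rewrite integral_cell_bound.
have mcn1 : measurable_fun setT (fun p : X * Y * Z => (cn p.1)%:E).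
  by apply: (measurableT_comp mcn); exact: measurable_fst.
have mSZ g : measurable ((grid \o kappa \o @projsnd _ _ (X * Y)%type Z) @^-1` [set g]).
  by rewrite comp_preimage -[_ @^-1` _]setTI; apply: measurable_funPT => //; exact: mS.
rewrite (integral_fiber mSZ)//; last by move=> p; rewrite lee_fin cn0.
have -> : e%:E = \sum_(g : G) e%:E * nu (S g).
  transitivity (\int[nu]_z e%:E); first by rewrite integral_probability_cst.
  rewrite (integral_fiber_cst mS nu (F := fun=> e%:E))//; last first.
    by move=> _; rewrite lee_fin ltW.
  by apply: eq_bigr => g _; rewrite setTI.
rewrite -big_split/=; apply: lee_sum => g _; rewrite setTI.
set A := _ @^-1` [set g]; have mA : measurable A := mSZ g.
have XZ B D : measurable B -> measurable D ->
    pi ((B `*` setT) `*` D) = rho (B `*` D).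
  move=> mB mD; rewrite -piXZ; last exact: measurableX.
  by congr (pi _); apply/seteqP; split=> -[[x y] z] /=; rewrite /projXZ/=; tauto.
have YZ B D : measurable B -> measurable D ->
    pi ((setT `*` B) `*` D) = mu B * nu D.
  move=> mB mD; rewrite -product_measure1E// -piYZ; last exact: measurableX.
  by congr (pi _); apply/seteqP; split=> -[[x y] z] /=; rewrite /projYZ/=; tauto.
have nuA : pi A = nu (S g).
  rewrite -[RHS]mul1e -(probability_setT mu) -YZ//.
  by congr (pi _); apply/seteqP; split=> -[[x y] z] //= [].
have [A0|A0] := eqVneq (pi A) 0.
  rewrite big1; last first.
    move=> a _; apply/eqP; rewrite mule_eq0; apply/orP; right.
    rewrite eq_le measure_ge0 andbT -A0 -XZ//; last exact: mu_fiber.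
    apply: le_measure; rewrite ?inE//.
      by apply: measurableX => //; apply: measurableX => //; exact: mu_fiber.
    by move=> [[x y] z] [].
  by rewrite adde_ge0//; [apply: integral_ge0 => p _; rewrite lee_fin cn0
                          |rewrite mule_ge0// lee_fin ltW].
have [Qm [QE Qf]] := conditional_probability mA A0.
pose gam := distribution Qm (@projfst _ _ (X * Y)%type Z).
have piA : pi A \is a fin_num by rewrite fin_num_measure.
have gamY : distribution gam projsnd ≡μ mu.
  move=> B mB; apply: (@muleI_fin _ (pi A)) => //.
  transitivity (pi A * Qm (projfst @^-1` (projsnd @^-1` B))) => //; rewrite -QE; last first.
    rewrite -comp_preimage -[_ @^-1` _]setTI.
    exact: (measurableT_comp measurable_snd measurable_fst).
  rewrite [RHS]muleC nuA -YZ//.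
  by congr (pi _); apply/seteqP; split=> -[[x y] z] /=; rewrite /projsnd /projfst/=; tauto.
have gamX a : pi A * gam (cell a `*` setT) = rho (cell a `*` S g).
  rewrite -XZ//; last exact: mu_fiber.
  transitivity (pi A * Qm (projfst @^-1` (cell a `*` setT))) => //; rewrite -QE; last first.
    by rewrite -[_ @^-1` _]setTI; exact: measurable_funPT.
  by congr (pi _); apply/seteqP; split=> -[[x y] z] /=; rewrite /projfst/=; tauto.
have gf a : gam (cell a `*` setT) \is a fin_num by rewrite fin_num_measure.
have nuS0 : (0 < fine (nu (S g)))%R.
  by rewrite fine_gt0// -nuA lt_def A0/= -ge0_fin_numE// piA andbT.
(* Averaging over the points z of one grid cell preserves the rounding bounds. *)
have Gg : Gam g gam.
  split; [exact: gamY|move=> a].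
  have := rho_bounds a (mS g) (@subset_refl _ _).
  rewrite -gamX fineM// nuA mulrCA (mulrC (fine (nu _))) ler_pM2r// ler_pM2r//.
have := weighted_cost Gg Gg.2.
rewrite -(lee_pmul2l piA); last by rewrite lt_def A0 measure_ge0.
rewrite ge0_muleDr; last 2 first.
- by apply: integral_ge0 => p _; rewrite lee_fin cn0.
- by rewrite lee_fin ltW.
rewrite /gam {2}/distribution ge0_integral_pushforward//; last by move=> p _; rewrite lee_fin cn0.
rewrite preimage_setT -Qf//; last by move=> p; rewrite lee_fin cn0.
rewrite nuA (muleC (nu _) e%:E); apply: le_trans.
rewrite -sumEFin ge0_sume_distrr; last first.
  by move=> a _; rewrite lee_fin mulr_ge0// fine_ge0.
apply: lee_sum => a _.
rewrite -gamX -nuA [leRHS](_ : _ = pi A * (fine (gam (cell a `*` setT)) * H g a)%:E)//.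
by rewrite EFinM (fineK (gf a)) muleC -muleA.
Qed.

(** Given (x, z), y is drawn from the law attached to the grid point of [kappa z] and the cell of x.
    If the cells had the same masses under [kappa z] as under [opt g], then y would have law mu
    given z; the discrepancy is at most 1/N per cell. *)
Lemma cell_plan : exists pi : probability (X * Y * Z)%type R,
  [/\ distribution pi projXZ ≡μ rho,
   forall B C, measurable B -> measurable C ->
     (`|fine (pi (projYZ @^-1` (B `*` C))) - fine (mu B) * fine (nu C)| <= e)%R &
   \int[pi]_p (cn p.1)%:E = \int[nu]_z (J (kappa z))%:E].
Proof.
pose j (v : X * Z) : G * I := (grid (kappa v.2), u v.1).
have jE ga : j @^-1` [set ga] = cell ga.2 `*` S ga.1.
  by case: ga => g a; apply/seteqP; split=> -[x z] /=; rewrite /j/S/=; [case|move=> [<- <-]].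
have mj ga : measurable (j @^-1` [set ga]) by rewrite jE.
pose w (q : X * Z * Y) : X * Y * Z := ((q.1.1, q.2), q.1.2).
have mw : measurable_fun setT w.
  apply: measurable_fun_pair; first apply: measurable_fun_pair => //.
    exact: (measurableT_comp measurable_fst measurable_fst).
  exact: (measurableT_comp measurable_snd measurable_fst).
have [pi piE] := glueing mj (fun ga => k ga.1 ga.2) mw rho.
have piI E : measurable E -> pi E = \int[rho]_v \int[k (j v).1 (j v).2]_y (\1_E (w (v, y)))%:E.
  move=> mE; rewrite measure_integral_indic// piE//.
  by apply/measurable_EFinP; exact: measurable_indic.
exists pi; split.
- move=> A mA; transitivity (pi (projXZ @^-1` A)) => //; rewrite piI; last first.
    by rewrite -[_ @^-1` _]setTI; exact: measurable_funPT.
  rewrite [RHS]measure_integral_indic//.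
  apply: eq_integral => -[x z] _.
  by rewrite -[RHS](integral_probability_cst (k (j (x, z)).1 (j (x, z)).2)).
- move=> B C mB mC.
  have mTC : measurable (@setT X `*` C) by exact: measurableX.
  have piBC : pi (projYZ @^-1` (B `*` C)) =
      \sum_(g : G) \sum_(a : I) k g a B * rho (cell a `*` (S g `&` C)).
    rewrite piI; last first.
      rewrite -[_ @^-1` _]setTI; apply: measurable_funPT => //; exact: measurableX.
    transitivity (\int[rho]_(v in setT `*` C) k (j v).1 (j v).2 B).
      rewrite [RHS]integral_mkcond; apply: eq_integral => -[x z] _.
      rewrite patchE; case: ifPn => [|]; rewrite ?inE ?notin_setE.
        move=> [_ /= Cz]; rewrite measure_integral_indic//.
        apply: eq_integral => y _; rewrite !indicE; congr (_%:R%:E); congr (nat_of_bool _).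
        by apply/idP/idP; rewrite !inE /projYZ/=; tauto.
      move=> nC; rewrite integral0_eq// => y _; rewrite indicE memNset//=.
      by rewrite /projYZ/= => -[_ Cz]; apply: nC.
    rewrite (integral_fiber_cst mj rho (F := fun ga => k ga.1 ga.2 B))//.
    rewrite [RHS]pair_bigA/=; apply: eq_bigr => -[g a] _ /=; congr (_ * rho _).
    rewrite jE/=; apply/seteqP; split=> -[x z] /=; tauto.
  have nuC : (fine (nu C) = \sum_(g : G) fine (nu (S g `&` C)))%R.
    apply: EFin_inj; rewrite fineK ?fin_num_measure// -sumEFin.
    rewrite -[LHS]mul1e -integral_cst// (integral_fiber_cst mS nu (F := fun=> 1))//.
    apply: eq_bigr => g _; rewrite mul1e setIC fineK// fin_num_measure//.
    by apply: measurableI.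
  have Ng g : (`|\sum_(a : I) fine (k g a B) * fine (rho (cell a `*` (S g `&` C))) -
      fine (mu B) * fine (nu (S g `&` C))| <= fine (nu (S g `&` C)) * (#|I|%:R * (1 / N%:R)))%R.
    have mSC : measurable (S g `&` C) by exact: measurableI.
    have [[z Sz]|nS] := pselect (exists z, S g z); last first.
      have -> : S g `&` C = set0 by apply/seteqP; split=> z // [Sz _]; apply: nS; exists z.
      rewrite measure0/= mulr0 mul0r subr0 big1 ?normr0// => a _.
      by rewrite setX0 measure0 mulr0.
    (* The product coupling shows that g is realised, so [opt g] does have second marginal mu. *)
    pose gam : probability (X * Y)%type R := (kappa z \x mu)%E.
    have Gg : Gam g gam.
      split=> [D mD|a].
        rewrite /distribution /pushforward /gam -[RHS]mul1e -(probability_setT (kappa z)).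
        rewrite -product_measure1E//; congr ((_ \x _)%E _).
        by apply/seteqP; split=> -[x y] //= [].
      have -> : gam (cell a `*` setT) = kappa z (cell a) * mu setT.
        by apply: product_measure1E => //; exact: mu_fiber.
      by rewrite probability_setT mule1 -Sz; exact: grid_bounds.
    have [[_ ob] _] := optP Gg.
    rewrite (opt_marginal Gg mB) mulr_suml -sumrB.
    apply: le_trans (ler_norm_sum _ _ _) _.
    apply: (@le_trans _ _ (\sum_(a : I) fine (nu (S g `&` C)) / N%:R)%R); last first.
      by rewrite sumr_const -[leLHS]mulr_natl div1r mulrCA.
    apply: ler_sum => a _.
    have nu0 : (0 <= fine (nu (S g `&` C)))%R by exact: fine_ge0.
    have SCS : S g `&` C `<=` S g by exact: subIsetl.
    have /andP[r1 r2] := rho_bounds a mSC SCS.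
    have /andP[b1 b2] := ob a.
    have k1 : (fine (k g a B) <= 1)%R.
      by rewrite -lee_fin fineK ?fin_num_measure// probability_le1.
    move: r1 r2 b1 b2 nu0; set r := fine (rho _); set o := fine (opt _ _).
    set n := fine (nu _) => r1 r2 b1 b2 nu0.
    have -> : (fine (k g a B) * r - o * fine (k g a B) * n =
      fine (k g a B) * (r - o * n))%R by ring.
    rewrite normrM ger0_norm; last exact: fine_ge0.
    apply: (@le_trans _ _ `|r - o * n|%R); first by rewrite ler_piMl.
    (* Both N r and N o n lie between [g a] times n and [g a] + 1 times n, so r and o n differ by at
       most n / N. *)
    have b1n := ler_wpM2r nu0 b1; have b2n := ler_wpM2r nu0 b2.
    by rewrite ler_pdivlMr// -[X in (_ * X)%R](ger0_norm (ltW N0)) -normrM ler_norml; lra.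
  have -> : (fine (pi (projYZ @^-1` (B `*` C))) = \sum_(g : G) \sum_(a : I)
      fine (k g a B) * fine (rho (cell a `*` (S g `&` C))))%R.
    have mcS g a : measurable (cell a `*` (S g `&` C)).
      by apply: measurableX; [exact: mu_fiber|exact: measurableI].
    apply: EFin_inj; rewrite fineK ?fin_num_measure//; last first.
      rewrite -[_ @^-1` _]setTI; apply: measurable_funPT => //; exact: measurableX.
    rewrite piBC -sumEFin; apply: eq_bigr => g _; rewrite -sumEFin.
    by apply: eq_bigr => a _; rewrite EFinM !fineK ?fin_num_measure.
  rewrite nuC mulr_sumr -sumrB.
  apply: le_trans (ler_norm_sum _ _ _) _.
  apply: le_trans (ler_sum _ (fun g _ => Ng g)) _.
  rewrite -mulr_suml -nuC.
  have NI1 : (#|I|%:R * (1 / N%:R) <= e / 2)%R.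
    by apply: NI => //; rewrite lerDl; exact: Q0 (u point).
  have nuC1 : (fine (nu C) <= 1)%R.
    by rewrite -lee_fin fineK ?fin_num_measure// probability_le1.
  apply: (@le_trans _ _ (1 * (e / 2))%R); last first.
    by rewrite mul1r ler_pdivrMr// ler_peMr ?ltW// ltr1n.
  by apply: ler_pM => //; rewrite ?fine_ge0// mulr_ge0// divr_ge0// ltW.
- rewrite piE//; last 2 first.
    by apply: (measurableT_comp mcn); exact: measurable_fst.
    by move=> x; rewrite lee_fin cn0.
  transitivity (\int[rho]_v (H (j v).1 (j v).2)%:E).
    apply: eq_integral => -[x z] _; rewrite -H_E.
    by apply: eq_integral.
  rewrite (integral_fiber_cst mj rho (F := fun ga => (H ga.1 ga.2)%:E))//; last first.
    by move=> ga; rewrite lee_fin H0.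
  rewrite integral_cell_bound pair_bigA/=; apply: eq_bigr => -[g a] _ /=.
  by rewrite setTI jE.
Qed.

End plans.

End discretization.

(** * Monotone approximation of the cost *)

Lemma open_setX (S T : topologicalType) (U : set S) (V : set T) :
  open U -> open V -> open (U `*` V).
Proof.
move=> oU oV; rewrite openE => -[x y] [Ux Vy].
by exists (U, V) => //; split; exact: open_nbhs_nbhs.
Qed.

Section open_superlevels.
Context {R : realType} {d : measure_display}.

Lemma open_superlevel_measurable (W : polishType R d) (f : W -> R) :
  (forall t, open [set x | (t < f x)%R]) -> measurable_fun setT f.
Proof.
move=> of_; apply: (@measurability _ _ _ _ _ _ _ (RGenOInfty.measurableE R)) => _ [_ [r ->] <-].
rewrite setTI; apply: open_measurable_polish.
rewrite (_ : _ @^-1` _ = [set x | (r < f x)%R]); first exact: of_.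
by apply/seteqP; split=> x /=; rewrite in_itv/= andbT.
Qed.

(** A maximum started at 0 exceeds every negative level everywhere, so the superlevels of each block
    matter only for t >= 0, where they are the block or empty. *)
Lemma open_superlevel_bigmax (W : topologicalType) n (f : 'I_n -> W -> R) :
  (forall k t, (0 <= t)%R -> open [set x | (t < f k x)%R]) ->
  forall t, open [set x | (t < \big[Num.max/0%R]_(k < n) f k x)%R].
Proof.
move=> of_ t; have [t0|t0] := leP 0%R t; last first.
  rewrite (_ : mkset _ = setT); first exact: openT.
  apply/seteqP; split=> // x _ /=; apply: lt_le_trans t0 _.
  exact: bigmax_ge_id.
rewrite (_ : mkset _ = \bigcup_(k : 'I_n) [set x | (t < f k x)%R]).
  by apply: bigcup_open => k _; exact: of_.
apply/seteqP; split=> x /=; last first.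
  move=> [k _ /= tk]; apply: lt_le_trans tk _; exact: (le_bigmax _ (fun k => f k x)).
move=> tx; apply: contrapT => nx; move: tx; apply/negP; rewrite -leNgt.
apply: bigmax_le => // k _; rewrite leNgt; apply/negP => tk.
by apply: nx; exists k.
Qed.

End open_superlevels.

Section cost_approximation.
Context {R : realType} {dX dY : measure_display}.
Context {X : polishType R dX} {Y : polishType R dY}.
Context (c : X * Y -> R).
Hypothesis cc : continuous c.
Hypothesis c0 : forall p, (0 <= c p)%R.

Let B := sval (cid2 (polish_countable_basis X)).
Let oB n : open (B n). Proof. by rewrite /B; case: cid2. Qed.
Let C := sval (cid2 (polish_countable_basis Y)).
Let oC n : open (C n). Proof. by rewrite /C; case: cid2. Qed.

(** Codes of blocks: two basic open sets and a rational height. A natural number that decodes to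
    nothing, or to a block not lying below c, gets height 0, which is harmless in a maximum started
    at 0. *)
Let T := (nat * nat * (nat * nat) * rat)%type.
Let below (t : T) :=
  `[< 0 <= ratr t.2 :> R /\ forall x y, B t.1.1 x -> C t.1.2 y -> ratr t.2 <= c (x, y) >]%R.
Let height k : R :=
  if unpickle k is Some t then if below t then ratr t.2 else 0%R else 0%R.
Let U k : set X := if (unpickle k : option T) is Some t then B t.1.1 else set0.
Let V k : set Y := if (unpickle k : option T) is Some t then C t.1.2 else set0.

Let height_ge0 k : (0 <= height k)%R.
Proof.
rewrite /height; case: unpickle => [t|//]; case: ifPn => // /asboolP[]//.
Qed.

Let height_le k x y : U k x -> V k y -> (height k <= c (x, y))%R.
Proof.
rewrite /height /U /V; case: unpickle => [t|//] Ux Vy; case: ifPn => [/asboolP[_]|_].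
  exact.
exact: c0.
Qed.

Let oU k : open (U k).
Proof. by rewrite /U; case: unpickle => [t|]; [exact: oB|exact: open0]. Qed.
Let oV k : open (V k).
Proof. by rewrite /V; case: unpickle => [t|]; [exact: oC|exact: open0]. Qed.

Definition approx_index n (x : X) : {ffun 'I_n -> bool} := [ffun k : 'I_n => `[< U k x >]].

Definition approx_cost n (a : {ffun 'I_n -> bool}) (y : Y) : R :=
  \big[Num.max/0%R]_(k < n) (height k * (a k && `[< V k y >])%:R)%R.

Definition cost_bound n : R := \big[Num.max/0%R]_(k < n) height k.

Definition cost_approx n (p : X * Y) : R := approx_cost (approx_index n p.1) p.2.

Let block k (p : X * Y) : R := (height k * (`[< U k p.1 >] && `[< V k p.2 >])%:R)%R.

Let cost_approxE n p : cost_approx n p = \big[Num.max/0%R]_(k < n) block k p.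
Proof. by apply: eq_bigr => k _; rewrite ffunE. Qed.

Lemma approx_index_fiber n a : measurable (@approx_index n @^-1` [set a]).
Proof.
rewrite (_ : _ @^-1` _ = \bigcap_(k in [set: 'I_n]) (if a k then U k else ~` U k)).
  apply: fin_bigcap_measurable; first exact: finite_finset.
  by move=> k _; case: (a k); [|apply: measurableC]; exact: open_measurable_polish.
apply/seteqP; split=> x /=.
  by move=> <- k _; rewrite ffunE; case: asboolP.
move=> xa; apply/ffunP => k; rewrite ffunE; have := xa k I.
by case: (a k) => // ux; [exact/asboolP|apply/asboolP].
Qed.

Lemma approx_cost_ge0 n a y : (0 <= @approx_cost n a y)%R.
Proof. exact: bigmax_ge_id. Qed.

Lemma approx_cost_le n a y : (@approx_cost n a y <= cost_bound n)%R.
Proof.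
apply: le_bigmax2 => k _; rewrite ler_piMr//.
by case: (_ && _).
Qed.

Lemma approx_cost_measurable n a : measurable_fun setT (@approx_cost n a).
Proof.
apply: open_superlevel_measurable; apply: open_superlevel_bigmax => k t t0.
have [/andP[ak tk]|ntk] := boolP (a k && (t < height k)%R).
  rewrite (_ : mkset _ = V k)//.
  apply/seteqP; split=> y /=; rewrite ak/=; case: asboolP => //.
    by rewrite mulr0 ltNge t0.
  by rewrite mulr1.
rewrite (_ : mkset _ = set0); first exact: open0.
apply/seteqP; split=> y //= tk; move: ntk; rewrite negb_and => /orP[/negbTE ak|/negP].
  by move: tk; rewrite ak mulr0 ltNge t0.
apply; apply: lt_le_trans tk _; rewrite ler_piMr//.
by case: (_ && _).
Qed.

Lemma cost_approx_open n t : open [set p | (t < cost_approx n p)%R].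
Proof.
under eq_set do rewrite cost_approxE.
apply: open_superlevel_bigmax => k {}t t0.
have [tk|kt] := ltP t (height k).
  rewrite (_ : mkset _ = U k `*` V k); first exact: open_setX.
  apply/seteqP; split=> -[x y] /=; rewrite /block/=.
    by case: (asboolP (U k x)) => Ux; case: (asboolP (V k y)) => Vy //=; rewrite mulr0 ltNge t0.
  by move=> [Ux Vy]; rewrite !asboolT// mulr1.
rewrite (_ : mkset _ = set0); first exact: open0.
apply/seteqP; split=> y //= tk; move: kt; apply/negP; rewrite -ltNge.
apply: lt_le_trans tk _; rewrite ler_piMr//.
by case: (_ && _).
Qed.

Lemma cost_approx_measurable n : measurable_fun setT (cost_approx n).
Proof. by apply: open_superlevel_measurable; exact: cost_approx_open. Qed.

Lemma cost_approx_le n p : (cost_approx n p <= c p)%R.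
Proof.
rewrite cost_approxE; apply: bigmax_le => [|k _]; first exact: c0.
rewrite /block; case: p => x y /=; have := @height_le k x y.
case: asboolP => [Ux|_] /=; last by rewrite mulr0 => _; exact: c0.
case: asboolP => [Vy|_] /=; last by rewrite mulr0 => _; exact: c0.
by rewrite mulr1; apply.
Qed.

Lemma cost_approx_nd p : {homo cost_approx^~ p : m n / (m <= n)%N >-> (m <= n)%R}.
Proof.
move=> m n mn; rewrite !cost_approxE.
exact: (@le_bigmax_ord _ _ 0%R m n xpredT (block^~ p)).
Qed.

Lemma cost_approx_cvg p : cost_approx n p @[n --> \oo] --> c p.
Proof.
apply/cvgrPdist_lt => e e0.
have [n ne] : exists n, (c p - e < cost_approx n p)%R.
  (* If c p < e then c_0 = 0 is already close enough. Otherwise a rational between c p - e and c p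
     is nonnegative, as [below] requires. *)
  have [ce|ce] := ltP (c p - e)%R 0%R.
    by exists 0%N; apply: lt_le_trans ce _; exact: approx_cost_ge0.
  have [q qc] := @rat_in_itvoo R (c p - e)%R (c p) ltac:(by rewrite ltrBlDr ltrDl).
  move: qc; rewrite in_itv/= => /andP[q1 q2].
  have oq : open [set z | (ratr q < c z)%R].
    by rewrite -preimage_itvoy; move/continuousP : cc; apply; exact: rray_open.
  case: p ce q1 q2 => x y ce q1 q2.
  have [[A D] /= [nA nD] AD] : nbhs (x, y) [set z | (ratr q < c z)%R].
    exact: open_nbhs_nbhs.
  have [i Bi BiA] : exists2 i, B i x & B i `<=` A°.
    by rewrite /B; case: cid2 => /= B' _; apply => //; exact: open_interior.
  have [j Cj CjD] : exists2 i, C i y & C i `<=` D°.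
    by rewrite /C; case: cid2 => /= C' _; apply => //; exact: open_interior.
  pose t : T := (i, j, q).
  exists (pickle t).+1; apply: (lt_le_trans q1).
  rewrite cost_approxE.
  apply: le_trans (le_bigmax 0%R (fun k : 'I_(pickle t).+1 => block k (x, y)) ord_max).
  rewrite /block/= /U /V /height pickleK/= !asboolT// mulr1 ifT//.
  apply/asboolP; split=> /=.
    by apply: le_trans ce (ltW q1).
  move=> x' y' /BiA/interior_subset Ax /CjD/interior_subset Dy.
  by apply: ltW; exact: (AD (x', y')).
near=> m; rewrite ger0_norm ?subr_ge0 ?cost_approx_le//.
rewrite ltrBlDr addrC -ltrBlDr; apply: lt_le_trans ne _.
by apply: cost_approx_nd; near: m; exact: nbhs_infty_ge.
Unshelve. all: by end_near.
Qed.

End cost_approximation.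

(** * Transport cost as a liminf, and optimal plans, for nonnegative costs *)

Lemma limn_einfE (R : realType) (u : (\bar R)^nat) : limn_einf u = ereal_sup (range (einfs u)).
Proof.
rewrite limn_einf_lim; apply/cvg_lim => //.
by apply: ereal_nondecreasing_cvgn; exact: nondecreasing_einfs.
Qed.

Lemma limn_einf_le_gap (R : realType) (u : (\bar R)^nat) (v : \bar R) :
  (forall n, u n <= v + (n.+1%:R^-1)%:E) -> limn_einf u <= v.
Proof.
move=> uv; rewrite limn_einfE; apply: ge_ereal_sup => _ [n _ <-].
apply/lee_addgt0Pr => e e0.
near \oo => m; apply: (@le_trans _ _ (u m)).
  apply: ereal_inf_lbound; exists m => //=; near: m; exact: nbhs_infty_ge.
apply: le_trans (uv m) _; rewrite leeD2l// lee_fin ltW//.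
by near: m; exact: near_infty_natSinv_lt (PosNum e0).
Unshelve. all: by end_near.
Qed.

Lemma limn_einf_frequently (R : realType) (u : (\bar R)^nat) (t e : R) :
  limn_einf u <= t%:E -> (0 < e)%R -> forall k, exists2 n, (k <= n)%N & u n <= (t + e)%:E.
Proof.
rewrite limn_einfE => ut e0 k.
have : einfs u k < (t + e)%:E.
  apply: (@le_lt_trans _ _ t%:E); last by rewrite lte_fin ltrDl.
  by apply: le_trans ut; apply: ereal_sup_ubound; exists k.
by move=> /ereal_inf_lt[_ [n /= kn <-]] /ltW; exists n.
Qed.

Lemma product_measure_eql (R : realType) dY dZ (Y : measurableType dY) (Z : measurableType dZ)
    (m1 m2 : probability Y R) (nu : probability Z R) :
  m1 ≡μ m2 -> (m1 \x nu) ≡μ (m2 \x nu).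
Proof.
by move=> m12 A mA; apply: eq_measure_integral => B mB _; exact: m12.
Qed.

Section nonnegative_cost.
Context {R : realType} {dX dY dZ : measure_display}.
Context {X : polishType R dX} {Y : polishType R dY} {Z : polishType R dZ}.
Implicit Types (mu : probability Y R) (kap : probability X R).

Let gap n : R := n.+1%:R^-1.
Let gap0 n : (0 < gap n)%R. Proof. by rewrite invr_gt0. Qed.

Definition approx_bound (c : X * Y -> R) mu n kap : R :=
  cell_bound (@approx_index_fiber _ _ X n)
    (@approx_cost_measurable _ _ _ _ _ c n) (@approx_cost_ge0 _ _ _ _ _ c n)
    (@approx_cost_le _ _ _ _ _ c n) mu (gap0 n) kap.

Context (c : X * Y -> R).
Hypothesis cc : continuous c.
Hypothesis c0 : forall p, (0 <= c p)%R.

Let J := approx_bound c.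

Let J0 mu n kap : (0 <= J mu n kap)%R.
Proof. exact: cell_bound_ge0. Qed.

Let mc : measurable_fun setT c.
Proof. exact: polish_continuous_measurable. Qed.

Let J_le mu n kap (gam : probability (X * Y)%type R) : couplings kap mu gam ->
  (J mu n kap)%:E <= \int[gam]_p (c p)%:E + (gap n)%:E.
Proof.
move=> [g1 g2]; apply: le_trans (cell_bound_le _ _ _ _ _ g1 g2) _.
rewrite leeD2r//; apply: ge0_le_integral => //.
- by move=> p _; rewrite lee_fin; exact: approx_cost_ge0.
- by apply/measurable_EFinP; exact: cost_approx_measurable.
- by apply/measurable_EFinP.
- by move=> p _; rewrite lee_fin; exact: cost_approx_le.
Qed.

Let J_le_transport mu n kap : (J mu n kap)%:E <= transport_cost c kap mu + (gap n)%:E.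
Proof.
rewrite -leeBlDr//; apply: le_ereal_inf_tmp => _ [gam Cgam <-].
by rewrite leeBlDr//; exact: J_le.
Qed.

Section kernel.
Context (rho : probability (X * Z)%type R) (nu : probability Z R).
Context (kappa : Z -> probability X R).
Hypothesis mkappa : forall A, measurable A -> measurable_fun setT (fun z => kappa z A).
Hypothesis rhoE : forall A B, measurable A -> measurable B ->
  rho (A `*` B) = \int[nu]_(z in B) kappa z A.

Let mJ mu n : measurable_fun setT (fun z => J mu n (kappa z)).
Proof. exact: measurable_cell_bound. Qed.

(** Along good indices [N k] >= k the glued plans have a vanishing YZ-error, so they have a limit
    plan over [rho] and mu. For fixed n the c_n-cost is below the c_(N k)-cost once k >= n, hence at
    most t in the limit; monotone convergence in n then reaches c. *)
Lemma plan_of_approx_bound mu (t : R) :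
  (forall e : R, (0 < e)%R -> forall k, exists2 n, (k <= n)%N &
    \int[nu]_z (J mu n (kappa z))%:E <= (t + e)%:E) ->
  exists2 pi, plans_to rho nu mu pi & triple_cost c pi <= t%:E.
Proof.
move=> Ht.
have /choice[N NP] : forall k, exists n, (k <= n)%N /\
    \int[nu]_z (J mu n (kappa z))%:E <= (t + gap k)%:E.
  by move=> k; have [n kn nt] := Ht _ (gap0 k) k; exists n.
have /choice[P PP] : forall k, exists P : probability (X * Y * Z)%type R,
    [/\ distribution P projXZ ≡μ rho,
     forall B C, measurable B -> measurable C ->
       (`|fine (P (projYZ @^-1` (B `*` C))) - fine (mu B) * fine (nu C)| <= gap (N k))%R &
     \int[P]_p (cost_approx c (N k) p.1)%:E = \int[nu]_z (J mu (N k) (kappa z))%:E].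
  by move=> k; exact: cell_plan mkappa rhoE.
have gapN k : (gap (N k) <= gap k)%R.
  by rewrite lef_pV2 ?posrE// ler_nat ltnS; exact: (NP k).1.
have gap_lt e : (0 < e)%R -> \forall k \near \oo, (gap k < e)%R.
  by move=> e0; exact: near_infty_natSinv_lt (PosNum e0).
have PY k B : measurable B -> (`|fine (P k (projY @^-1` B)) - fine (mu B)| <= gap k)%R.
  move=> mB; have [_ /(_ B setT mB measurableT) + _] := PP k.
  rewrite probability_setT mulr1 => PB; apply: le_trans (gapN k).
  by rewrite (_ : projY @^-1` B = projYZ @^-1` (B `*` setT))//; apply/seteqP; split=> -[[x y] z] //= [].
have PYcvg B : measurable B -> fine (P k (projY @^-1` B)) @[k --> \oo] --> fine (mu B).
  move=> mB; apply/cvgrPdist_lt => e e0; near=> k.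
  by rewrite distrC; apply: le_lt_trans (PY k _ mB) _; near: k; exact: gap_lt.
have PXZ k : distribution (P k) projXZ ≡μ rho by have [] := PP k.
have PYZ U V : measurable U -> measurable V ->
    (fine (P k (projYZ @^-1` (U `*` V))) - fine (P k (projY @^-1` U)) * fine (nu V))%R
      @[k --> \oo] --> (0 : R)%R.
  move=> mU mV; apply/cvgrPdist_lt => e e0; near=> k.
  rewrite sub0r normrN.
  have [_ /(_ U V mU mV) PUV _] := PP k.
  have PU := PY k _ mU.
  have nuV : (0 <= fine (nu V) <= 1)%R.
    by rewrite fine_ge0//= -lee_fin fineK ?fin_num_measure// probability_le1.
  have ge : (gap k < e / 2)%R by near: k; apply: gap_lt; rewrite divr_gt0.
  have := gapN k.
  move: PUV PU; set a := fine (P k _); set b := fine (P k _).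
  set m := fine (mu U); set v := fine (nu V) in nuV *.
  move=> PUV PU gN.
  (* The glued plan is compared with mu, whereas [plan_limit] wants its own Y-marginal; the
     difference is a second error of the same size. *)
  have -> : (a - b * v = (a - m * v) - (b - m) * v)%R by ring.
  apply: le_lt_trans (ler_normB _ _) _; rewrite normrM (ger0_norm (andP nuV).1).
  have : (`|b - m| * v <= `|b - m|)%R by rewrite ler_piMr// (andP nuV).2.
  by lra.

have tightY e : (0 < e)%R -> exists2 K : set Y, compact K &
    \forall k \near \oo, (1 - e)%:E <= P k (projY @^-1` K).
  move=> e0.
  have [K cK muK] := @ulam _ _ _ mu (e / 2)%R ltac:(by rewrite divr_gt0).
  exists K => //; near=> k.
  have ge : (gap k < e / 2)%R by near: k; apply: gap_lt; rewrite divr_gt0.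
  have mK := compact_measurable_polish cK.
  have mPK : measurable (@projY _ _ _ X Y Z @^-1` K).
    by rewrite -[_ @^-1` _]setTI; exact: measurable_funPT.
  have := PY k _ mK; rewrite ler_distl => /andP[+ _].
  rewrite -(@fineK _ (P k _)) ?fin_num_measure// lee_fin.
  by move: muK; rewrite -{1}(@fineK _ (mu K)) ?fin_num_measure// lee_fin; lra.
have [m [mXZ mYZ mmu mle]] := plan_limit PXZ PYZ tightY.
exists m.
  split=> // A mA; rewrite mYZ//; apply: product_measure_eql => //.
  exact: mmu.
have mcn n : measurable_fun setT (fun p : X * Y * Z => cost_approx c n p.1).
  by apply: measurableT_comp; [exact: cost_approx_measurable|exact: measurable_fst].
have cnt n : \int[m]_p (cost_approx c n p.1)%:E <= t%:E.
  apply: mle => // [p|s|e e0].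
  - exact: approx_cost_ge0.
  - rewrite (_ : mkset _ = fst @^-1` [set p | (s < cost_approx c n p)%R])//.
    apply: open_comp; last exact: cost_approx_open.
    by move=> [p z] _; exact: cvg_fst.
  near=> k.
  have [_ _ PJ] := PP k.
  have nk : (n <= N k)%N.
    by apply: leq_trans (NP k).1; near: k; exact: nbhs_infty_ge.
  apply: (@le_trans _ _ (\int[P k]_p (cost_approx c (N k) p.1)%:E)).
    apply: ge0_le_integral => //.
    + by move=> p _; rewrite lee_fin; exact: approx_cost_ge0.
    + by apply/measurable_EFinP.
    + by apply/measurable_EFinP.
    + by move=> p _; rewrite lee_fin; exact: cost_approx_nd.
  rewrite PJ; apply: le_trans (NP k).2 _.
  by rewrite lee_fin lerD2l ltW//; near: k; exact: gap_lt.
rewrite /triple_cost.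
have cvgc : \int[m]_p (cost_approx c n p.1)%:E @[n --> \oo] --> \int[m]_p (c p.1)%:E.
  have -> : \int[m]_p (c p.1)%:E = \int[m]_p limn (fun n => (cost_approx c n p.1)%:E).
    apply: eq_integral => p _; apply/esym/cvg_lim => //.
    by apply: cvg_EFin; [exact: nearW|exact: cost_approx_cvg].
  apply: cvg_monotone_convergence => //.
  - by move=> n; apply/measurable_EFinP.
  - by move=> n p _; rewrite lee_fin; exact: approx_cost_ge0.
  - by move=> p _ i j ij; rewrite lee_fin; exact: cost_approx_nd.
rewrite -(cvg_lim _ cvgc)//; apply: lime_le; first by apply/cvg_ex; eexists; exact: cvgc.
exact: nearW.
Unshelve. all: by end_near.
Qed.

End kernel.

Lemma transport_cost_ge0 kap mu : 0 <= transport_cost c kap mu.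
Proof.
apply: le_ereal_inf_tmp => _ [gam _ <-]; apply: integral_ge0 => p _.
by rewrite lee_fin.
Qed.

Lemma transport_costE kap mu :
  transport_cost c kap mu = limn_einf (fun n => (J mu n kap)%:E).
Proof.
apply/eqP; rewrite eq_le; apply/andP; split; last first.
  by apply: limn_einf_le_gap => n; exact: J_le_transport.
have transport_le (t : R) :
    limn_einf (fun n => (J mu n kap)%:E) <= t%:E -> transport_cost c kap mu <= t%:E.
  (* A plan over kap * \d_z and mu is a coupling of kap and mu. *)
  move=> Jt; pose z : Z := point; pose kz : probability (X * Z)%type R := (kap \x \d_z)%E.
  have kzE A B : measurable A -> measurable B -> kz (A `*` B) = \int[\d_z]_(_ in B) kap A.
    by move=> mA mB; rewrite integral_cst//; exact: product_measure1E.
  have mk A : measurable A -> measurable_fun setT (fun _ : Z => kap A) by [].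
  have [e e0 k|pi [piXZ piYZ] pit] := plan_of_approx_bound (mu := mu) (t := t) mk kzE.
    have [n kn nt] := limn_einf_frequently Jt e0 k; exists n => //.
    by rewrite (integral_probability_cst (\d_z)).
  pose gam := distribution pi (@projfst _ _ (X * Y)%type Z).
  apply: le_trans pit.
  have -> : triple_cost c pi = \int[gam]_p (c p)%:E.
    rewrite ge0_integral_pushforward//; first by apply/measurable_EFinP.
    by move=> p _; rewrite lee_fin.
  apply: ereal_inf_lbound; exists gam => //; split.
    move=> A mA; transitivity (distribution pi projXZ (A `*` setT)).
      by congr (pi _); apply/seteqP; split=> -[[x y] w] //= [].
    rewrite piXZ; last exact: measurableX.
    transitivity (kap A * (\d_z : probability Z R) setT); first exact: product_measure1E.
    by rewrite probability_setT mule1.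
  move=> A mA; transitivity (distribution pi projYZ (A `*` setT)).
    by congr (pi _); apply/seteqP; split=> -[[x y] w] //= [].
  rewrite piYZ; last exact: measurableX.
  transitivity (mu A * (\d_z : probability Z R) setT); first exact: product_measure1E.
  by rewrite probability_setT mule1.
case: (limn_einf _) transport_le => [t|_|]; [exact|exact: leey|].
(* A liminf of -oo would bound the nonnegative transport cost by -1. *)
move=> /(_ (-1)%R (leNye _)) /(le_trans (transport_cost_ge0 _ _)).
by rewrite lee_fin oppr_ge0 ler10.
Qed.

Section total.
Context (rho : probability (X * Z)%type R) (nu : probability Z R).
Context (kappa : Z -> probability X R).
Hypothesis mkappa : forall A, measurable A -> measurable_fun setT (fun z => kappa z A).
Hypothesis rhoE : forall A B, measurable A -> measurable B ->
  rho (A `*` B) = \int[nu]_(z in B) kappa z A.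

Let mJ mu n : measurable_fun setT (fun z => (J mu n (kappa z))%:E).
Proof. by apply/measurable_EFinP; exact: measurable_cell_bound. Qed.

Lemma measurable_transport_cost mu :
  measurable_fun setT (fun z => transport_cost c (kappa z) mu).
Proof.
under eq_fun do rewrite transport_costE.
rewrite (_ : (fun z => _) = (fun z => - limn_esup (fun n => - (J mu n (kappa z))%:E))); last first.
  by apply/funext => z; rewrite -[RHS]limn_einfN; congr limn_einf; apply/funext => n; exact/esym/oppeK.
apply: measurableT_comp => //; apply: measurable_fun_limn_esup => n.
exact: measurableT_comp.
Qed.

Lemma total_cost_le_triple_cost mu pi : plans_to rho nu mu pi ->
  total_cost c nu kappa mu <= triple_cost c pi.
Proof.
move=> [piXZ piYZ]; rewrite /total_cost.
under eq_integral do rewrite transport_costE.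
apply: le_trans (fatou _ measurableT (mJ mu) _) _.
  by move=> n z _; rewrite lee_fin.
apply: limn_einf_le_gap => n.
apply: le_trans (integral_cell_bound_le _ _ _ _ _ mkappa rhoE piXZ piYZ) _.
rewrite leeD2r//; apply: ge0_le_integral => //.
- by move=> p _; rewrite lee_fin; exact: approx_cost_ge0.
- apply/measurable_EFinP.
  exact: (measurableT_comp (cost_approx_measurable c n) measurable_fst).
- apply/measurable_EFinP; exact: (measurableT_comp mc measurable_fst).
- by move=> p _; rewrite lee_fin; exact: cost_approx_le.
Qed.

Lemma plan_le_total_cost mu : total_cost c nu kappa mu < +oo ->
  exists2 pi, plans_to rho nu mu pi & triple_cost c pi <= total_cost c nu kappa mu.
Proof.
move=> ltoo.
have fin : total_cost c nu kappa mu \is a fin_num.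
  by rewrite ge0_fin_numE//; apply: integral_ge0 => z _; exact: transport_cost_ge0.
rewrite -(fineK fin); apply: plan_of_approx_bound mkappa rhoE _ _ _ => e e0 k.
near \oo => n; exists n; first by near: n; exact: nbhs_infty_ge.
apply: (@le_trans _ _ (\int[nu]_z (transport_cost c (kappa z) mu + (gap n)%:E))).
  apply: ge0_le_integral => //.
  - by move=> z _; rewrite lee_fin.
  - by apply: emeasurable_funD => //; exact: measurable_transport_cost.
rewrite ge0_integralD//; last 3 first.
- by move=> z _; exact: transport_cost_ge0.
- exact: measurable_transport_cost.
- by move=> z _; rewrite lee_fin ltW.
rewrite (integral_probability_cst nu) EFinD fineK// leeD2l// lee_fin ltW//.
by near: n; exact: near_infty_natSinv_lt (PosNum e0).
Unshelve. all: by end_near.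
Qed.

End total.

End nonnegative_cost.

(** * Costs bounded below *)

Lemma ge0_integralD_cst (R : realType) d (T : measurableType d) (P : probability T R)
    (g : T -> \bar R) (a : R) : measurable_fun setT g -> (forall x, 0 <= g x) ->
  \int[P]_x (g x + a%:E) = \int[P]_x g x + a%:E.
Proof.
move=> mg g0; have mga : measurable_fun setT (fun x => g x + a%:E).
  exact: emeasurable_funD.
pose h x := g x + a%:E.
(* As g need not be integrable and a may be negative, additivity does not apply to g + a directly;
   but its negative part is at most |a|, so that its integral is finite and can be cancelled. *)
have hn x : h^\- x <= `|a|%:E.
  rewrite funenegE /h ge_max lee_fin normr_ge0 andbT.
  case: (g x) (g0 x) => [r| |]//; rewrite ?lee_fin ?addye ?leNye// => r0.
  by have := ler_norm (- a)%R; rewrite normrN; lra.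
(* Shifted so that all terms are nonnegative and can be integrated separately. *)
have ha x : g x + h^\- x + `|a|%:E = h^\+ x + (`|a| - a)%:E.
  rewrite funeposE funenegE /h; case: (g x) (g0 x) => [r| |]//= r0.
    rewrite -[r%:E + a%:E]EFinD -!EFin_max -!EFinD; congr _%:E.
    by rewrite /Order.max; case: ifPn; case: ifPn; rewrite -?leNgt; lra.
  by rewrite maxNye adde0 !addye// maxye addye.
have fh : \int[P]_x h^\- x \is a fin_num.
  rewrite ge0_fin_numE; last exact: integral_ge0.
  apply: (@le_lt_trans _ _ (\int[P]_x `|a|%:E)); last by rewrite (integral_probability_cst P) ltry.
  apply: ge0_le_integral => //.
  exact: measurable_funeneg.
have := @eq_integral _ _ _ P setT _ _ (fun x _ => ha x).
rewrite ge0_integralD//; last 2 first.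
- by move=> x _; rewrite adde_ge0.
- by apply: emeasurable_funD => //; exact: measurable_funeneg.
rewrite ge0_integralD//; last exact: measurable_funeneg.
rewrite [RHS]ge0_integralD//; last 2 first.
- exact: measurable_funepos.
- by move=> x _; rewrite lee_fin subr_ge0 ler_norm.
rewrite !(integral_probability_cst P) => H.
rewrite [LHS]integralE -/h -(fineK fh).
move: H; rewrite -(fineK fh); move: (fine _) => r.
have : 0 <= \int[P]_x h^\+ x by exact: integral_ge0.
have : 0 <= \int[P]_x g x by exact: integral_ge0.
case: (\int[P]_x g x) => [s| |]//; case: (\int[P]_x h^\+ x) => [t| |]// _ _.
move=> /= H; have {}H : (s + r + `|a| = t + (`|a| - a))%R by exact: EFin_inj H.
by rewrite -EFinB -EFinD; congr EFin; lra.
Qed.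

Lemma product_measure_eqr (R : realType) dY dZ (Y : measurableType dY) (Z : measurableType dZ)
    (mu : probability Y R) (n1 n2 : probability Z R) :
  n1 ≡μ n2 -> (mu \x n1) ≡μ (mu \x n2).
Proof.
move=> n12 A mA; apply: eq_integral => y _ /=; apply: n12.
exact: measurable_xsection.
Qed.

Section shift.
Context {R : realType} {dX dY dZ : measure_display}.
Context {X : polishType R dX} {Y : polishType R dY} {Z : polishType R dZ}.
Context (c : X * Y -> R) (a : R).
Hypothesis cc : continuous c.
Hypothesis ca : forall p, (a <= c p)%R.

Let c' p : R := (c p - a)%R.

Lemma shifted_cost_ge0 p : (0 <= c' p)%R.
Proof. by rewrite subr_ge0. Qed.

Lemma shifted_cost_continuous : continuous c'.
Proof. by move=> p; apply: cvgB; [exact: cc|exact: cvg_cst]. Qed.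

Let mc' : measurable_fun setT c'.
Proof. exact: polish_continuous_measurable shifted_cost_continuous. Qed.

Let cE p : (c p)%:E = (c' p)%:E + a%:E.
Proof. by rewrite -EFinD subrK. Qed.

Lemma triple_cost_shift (pi : probability (X * Y * Z)%type R) :
  triple_cost c pi = triple_cost c' pi + a%:E.
Proof.
rewrite /triple_cost; under eq_integral do rewrite cE.
apply: ge0_integralD_cst => [|p]; last by rewrite lee_fin shifted_cost_ge0.
apply/measurable_EFinP; exact: (measurableT_comp mc' measurable_fst).
Qed.

Lemma transport_cost_shift (kap : probability X R) (mu : probability Y R) :
  transport_cost c kap mu = transport_cost c' kap mu + a%:E.
Proof.
have cI (gam : probability (X * Y)%type R) :
    \int[gam]_p (c p)%:E = \int[gam]_p (c' p)%:E + a%:E.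
  under eq_integral do rewrite cE.
  apply: ge0_integralD_cst => [|p]; last by rewrite lee_fin shifted_cost_ge0.
  exact/measurable_EFinP.
apply/eqP; rewrite eq_le; apply/andP; split.
  rewrite -leeBlDr//; apply: le_ereal_inf_tmp => _ [gam Cgam <-].
  by rewrite leeBlDr// -cI; apply: ereal_inf_lbound; exists gam.
apply: le_ereal_inf_tmp => _ [gam Cgam <-].
by rewrite cI leeD2r//; apply: ereal_inf_lbound; exists gam.
Qed.

Context (nu : probability Z R) (kappa : Z -> probability X R).
Hypothesis mkappa : forall A, measurable A -> measurable_fun setT (fun z => kappa z A).

Let mI mu : measurable_fun setT (fun z => transport_cost c' (kappa z) mu).
Proof. exact: measurable_transport_cost shifted_cost_continuous shifted_cost_ge0 _ mkappa _. Qed.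

Lemma transport_cost_well_defined mu :
  integral_well_defined nu (fun z => transport_cost c (kappa z) mu).
Proof.
have mc : measurable_fun setT (fun z => transport_cost c (kappa z) mu).
  by under eq_fun do rewrite transport_cost_shift; exact: emeasurable_funD.
split=> //.
apply: (@le_lt_trans _ _ (\int[nu]_z `|a|%:E)).
  apply: ge0_le_integral => //; first exact: measurable_funeneg.
  move=> z _; rewrite funenegE ge_max lee_fin normr_ge0 andbT transport_cost_shift leeNl.
  apply: (@le_trans _ _ a%:E); first by rewrite -EFinN lee_fin lerNl -normrN ler_norm.
  by rewrite leeDr// transport_cost_ge0//; exact: shifted_cost_ge0.
by rewrite (integral_probability_cst nu) ltry.
Qed.

Lemma total_cost_shift mu : total_cost c nu kappa mu = total_cost c' nu kappa mu + a%:E.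
Proof.
rewrite /total_cost; under eq_integral do rewrite transport_cost_shift.
apply: ge0_integralD_cst => // z.
exact: transport_cost_ge0 shifted_cost_ge0 _ _.
Qed.

End shift.

(** * Minimal plans *)

Section plans.
Context {R : realType} {dX dY dZ : measure_display}.
Context {X : polishType R dX} {Y : polishType R dY} {Z : polishType R dZ}.
Context (rho : probability (X * Z)%type R) (nu : probability Z R).
Hypothesis hnu : distribution rho projsnd ≡μ nu.
Implicit Types (mu : probability Y R) (pi : probability (X * Y * Z)%type R).

Let mXZ (A : set (X * Z)) : measurable A -> measurable (@projXZ _ _ _ X Y Z @^-1` A).
Proof. by move=> mA; rewrite -[_ @^-1` _]setTI; exact: measurable_funPT. Qed.

Let pi_nu pi : distribution pi projXZ ≡μ rho -> distribution pi projsnd ≡μ nu.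
Proof.
move=> piXZ A mA; rewrite -hnu//.
transitivity (distribution pi projXZ (projsnd @^-1` A)) => //.
by rewrite piXZ// -[_ @^-1` _]setTI; exact: measurable_funPT.
Qed.

(** With its converse below, this makes [plans rho] the union over mu of [plans_to rho nu mu], so
    minimising over plans can be done one Y-marginal at a time. *)
Lemma plans_to_plans mu pi : plans_to rho nu mu pi -> plans rho pi.
Proof.
move=> [piXZ piYZ]; split=> // A mA; rewrite piYZ//.
have piY : mu ≡μ distribution pi projY.
  move=> B mB; apply/esym.
  transitivity (distribution pi projYZ (B `*` setT)).
    by congr (pi _); apply/seteqP; split=> -[[x y] z] //= [].
  rewrite piYZ; last exact: measurableX.
  transitivity (mu B * nu setT); first exact: product_measure1E.
  by rewrite probability_setT mule1.
rewrite (product_measure_eql nu piY)//.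
by apply/esym; apply: product_measure_eqr => //; exact: pi_nu.
Qed.

Lemma plans_plans_to pi : plans rho pi -> plans_to rho nu (distribution pi projY) pi.
Proof.
move=> [piXZ piYZ]; split=> // A mA; rewrite piYZ//.
by apply: product_measure_eqr => //; exact: pi_nu.
Qed.

(** If no radius worked, there would be points [u n] farther than n from y0, each with some x in K
    of cost below t, against coercivity along u. *)
Lemma coercive_outside_ball (c : X * Y -> R) (K : set X) : locally_uniformly_coercive c ->
  heine_borel Y -> compact K -> forall t : R,
  exists2 L : set Y, compact L & forall x y, K x -> ~ L y -> (t <= c (x, y))%R.
Proof.
move=> [y0 coer] hb cK t.
suff [n Hn] : exists n : nat, forall y, (n%:R < mdist y0 y)%R -> forall x, K x -> (t <= c (x, y))%R.
  (* Radius n + 1 makes the distance exceed n strictly outside the ball; passing to the closure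
     costs one more unit in the bound on distances. *)
  exists (closure (ball y0 n.+1%:R)).
    apply: hb; first exact: closed_closure.
    exists y0, (n.+1%:R + 1)%R => y /(_ (ball y 1%R))[|z []].
      exact: nbhsx_ballx.
    move=> y0z yz; have := ball_triangle y0z (ball_sym yz).
    by rewrite ballEmdist => /ltW.
  move=> x y Kx nL; apply: Hn => //; rewrite ltNge; apply/negP => yn.
  apply/nL/subset_closure; rewrite ballEmdist/=; apply: le_lt_trans yn _.
  by rewrite ltr_nat.
apply: contrapT => /forallNP nH.
have /choice[u Hu] : forall n : nat, exists y, (n%:R < mdist y0 y)%R /\ exists2 x, K x & (c (x, y) < t)%R.
  move=> n; have /existsNP[y /not_implyP[ny /existsNP[x /not_implyP[Kx /negP]]]] := nH n.
  by rewrite -ltNge => ct; exists y; split=> //; exists x.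
have u_infty : mdist (u n) y0 @[n --> \oo] --> +oo%R.
  apply/cvgryPge => A; near=> n; rewrite metric_sym; apply: ltW; apply: lt_trans (Hu n).1.
  near: n; exact: nbhs_infty_gtr.
have := coer K cK u u_infty => /cvgeyPgt/(_ t) [n _ /(_ n (leqnn n))].
have [_ [x Kx ct]] := Hu n.
apply/negP; rewrite -leNgt; apply: le_trans (ltW (_ : (c (x, u n))%:E < t%:E)).
  by apply: ereal_inf_lbound; exists x.
by rewrite lte_fin.
Unshelve. all: by end_near.
Qed.

Context (c : X * Y -> R) (a : R).
Hypothesis cc : continuous c.
Hypothesis ca : forall p, (a <= c p)%R.
Let c' p : R := (c p - a)%R.
Let c'0 := shifted_cost_ge0 ca.
Let cc' := shifted_cost_continuous (a := a) cc.

Let mc' : measurable_fun setT (fun p : X * Y * Z => (c' p.1)%:E).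
Proof.
apply/measurable_EFinP.
exact: (measurableT_comp (polish_continuous_measurable cc') measurable_fst).
Qed.

(** Markov's inequality: where x is in K and y outside L the cost is at least s, so this event has
    small mass. K depends on [rho] alone, hence L serves all plans of cost at most C. *)
Lemma plans_tightY (C : R) (e : R) : locally_uniformly_coercive c -> heine_borel Y ->
  (0 < e)%R -> exists2 L : set Y, compact L &
  forall pi, distribution pi projXZ ≡μ rho -> triple_cost c' pi <= C%:E ->
    (1 - e)%:E <= pi (projY @^-1` L).
Proof.
move=> coer hb e0; have e20 : (0 < e / 2)%R by rewrite divr_gt0.
have [K cK rhoK] := @ulam _ _ _ (distribution rho projfst : probability X R) _ e20.
(* Chosen so that C / s <= e / 2; adding 1 to |C| keeps s positive for every C. *)
pose s : R := (2 * (`|C| + 1) / e)%R.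
have s0 : (0 < s)%R by rewrite divr_gt0// mulr_gt0// ltr_wpDl.
have [L cL LE] := coercive_outside_ball coer hb cK (s + a).
exists L => // pi piXZ piC.
have mK := compact_measurable_polish cK; have mL := compact_measurable_polish cL.
have mL' : measurable (@projY _ _ _ X Y Z @^-1` L).
  by rewrite -[_ @^-1` _]setTI; exact: measurable_funPT.
have mK' : measurable (@projXZ _ _ _ X Y Z @^-1` (projfst @^-1` K)).
  apply: mXZ; rewrite -[_ @^-1` _]setTI; exact: measurable_funPT.
apply: probability_setC_le => //.
pose A := ~` (projY @^-1` L) `&` (@projXZ _ _ _ X Y Z @^-1` (projfst @^-1` K)).
have mA : measurable A by apply: measurableI => //; exact: measurableC.
have piA : pi A <= (e / 2)%:E.
  have sA : s%:E * pi A <= C%:E.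
    apply: le_trans piC; rewrite -integral_cst//.
    apply: (@le_trans _ _ (\int[pi]_(p in A) (c' p.1)%:E)).
      apply: ge0_le_integral => //.
      - by move=> p _; rewrite lee_fin ltW.
      - exact: measurable_funTS.
      - move=> [[x y] z] [/= nL Kx]; rewrite lee_fin lerBrDr.
        exact: LE.
    apply: ge0_subset_integral => //.
    by move=> p _; rewrite lee_fin c'0.
  move: sA; rewrite -(@fineK _ (pi A)) ?fin_num_measure// -EFinM !lee_fin => sA.
  rewrite -(ler_pM2l s0); apply: le_trans sA _.
  have -> : (s * (e / 2) = `|C| + 1)%R by rewrite /s; field; exact: lt0r_neq0.
  by apply: le_trans (ler_norm _) _; rewrite lerDl.
have piK : pi (~` (projXZ @^-1` (projfst @^-1` K))) <= (e / 2)%:E.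
  apply: probability_ge_setC => //.
  apply: le_trans rhoK _; rewrite le_eqVlt; apply/orP; left; apply/eqP; symmetry.
  transitivity (distribution pi projXZ (projfst @^-1` K)) => //.
  by rewrite piXZ// -[_ @^-1` _]setTI; exact: measurable_funPT.
apply: (@le_trans _ _ (pi (A `|` ~` (projXZ @^-1` (projfst @^-1` K))))).
  apply: le_measure; rewrite ?inE//.
  - exact: measurableC.
  - by apply: measurableU => //; exact: measurableC.
  - move=> p nL; have [Kp|] := pselect ((projXZ @^-1` (projfst @^-1` K)) p).
      by left.
    by right.
apply: le_trans (measureU2 _ _ _) _ => //; first exact: measurableC.
by rewrite [e in leRHS](splitr e) EFinD; apply: leeD.
Qed.

Lemma exists_minimal_plan : (exists q : probability (X * Y * Z)%type R, plans rho q) ->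
  locally_uniformly_coercive c -> heine_borel Y ->
  exists2 pi : probability (X * Y * Z)%type R, plans rho pi & forall pi', plans rho pi' ->
    triple_cost c' pi <= triple_cost c' pi'.
Proof.
move=> [q plq] coer hb.
pose V := [set triple_cost c' pi | pi in plans rho].
have V0 : 0 <= ereal_inf V.
  apply: le_ereal_inf_tmp => _ [pi _ <-]; apply: integral_ge0 => p _.
  by rewrite lee_fin c'0.
have Vle pi : plans rho pi -> ereal_inf V <= triple_cost c' pi.
  by move=> plpi; apply: ereal_inf_lbound; exists pi.
suff [pi plpi piV] : exists2 pi, plans rho pi & triple_cost c' pi <= ereal_inf V.
  by exists pi => // pi' /Vle; exact: le_trans.
(* If the infimum is +oo, the given plan is minimal. *)
case: (ereal_inf V) (@lb_ereal_inf_adherent R V) V0 => [t||] adh V0 //; last first.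
  by exists q => //; exact: leey.
have /choice[P PP] : forall n : nat, exists pi,
    plans rho pi /\ triple_cost c' pi <= (t + n.+1%:R^-1)%:E.
  move=> n; have [|_ [pi plpi <-] /ltW pit] := adh (n.+1%:R^-1)%R _ isT; first by rewrite invr_gt0.
  by exists pi.
have [k|U V' mU mV|e e0|m [mXZ' mYZ _ mle]] := @plan_limit _ _ _ _ _ _ _ rho nu P.
- exact: (PP k).1.1.
- apply/cvgrPdist_lt => e e0; near=> n.
  rewrite sub0r normrN (_ : (_ - _)%R = 0%R) ?normr0//.
  have [pXZ pYZ] := plans_plans_to (PP n).1.
  apply/eqP; rewrite subr_eq0; apply/eqP.
  transitivity (fine (distribution (P n) projYZ (U `*` V'))) => //.
  rewrite pYZ; last exact: measurableX.
  transitivity (fine (distribution (P n) projY U * nu V')).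
    by congr fine; exact: product_measure1E.
  by rewrite fineM ?fin_num_measure.
(* The constant t + 1 bounds the whole minimizing sequence, since 1/(n+1) <= 1. *)
- have [L cL Lt] := plans_tightY (t + 1) coer hb e0; exists L => //.
  near=> n; apply: Lt; first exact: (PP n).1.1.
  apply: le_trans (PP n).2 _; rewrite lee_fin lerD2l.
  by rewrite invf_le1// ler1n.
- exists m; first exact: (@plans_to_plans (distribution m projY)).
  apply: mle => [|p|s|e e0].
  + exact/measurable_EFinP.
  + exact: c'0.
  + rewrite (_ : mkset _ = (c' \o fst) @^-1` `]s, +oo[%classic).
      apply: open_comp; last exact: rray_open.
      move=> p _; apply: continuous_comp; last exact: cc'.
      by case: p => p z; exact: cvg_fst.
    by apply/seteqP; split=> p /=; rewrite in_itv/= andbT.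
  near=> n; apply: le_trans (PP n).2 _; rewrite lee_fin lerD2l ltW//.
  by near: n; exact: near_infty_natSinv_lt (PosNum e0).
Unshelve. all: by end_near.
Qed.

End plans.

(** Existence is read off from the attainment result for the zero cost, whose total cost is finite.
    It covers the case of an infinite total cost, where any plan is optimal. *)
Lemma plans_to_nonempty (R : realType) (dX dY dZ : measure_display)
  (X : polishType R dX) (Y : polishType R dY) (Z : polishType R dZ)
  (rho : probability (X * Z)%type R) (nu : probability Z R) (kappa : Z -> probability X R)
  (mkappa : forall A, measurable A -> measurable_fun setT (fun z => kappa z A))
  (rhoE : forall A B, measurable A -> measurable B ->
    rho (A `*` B) = \int[nu]_(z in B) kappa z A) (mu : probability Y R) :
  exists pi : probability (X * Y * Z)%type R, plans_to rho nu mu pi.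
Proof.
pose zero (_ : X * Y) : R := 0%R.
have cz : continuous zero by move=> p; exact: cvg_cst.
have z0 p : (0 <= zero p)%R by [].
have [|pi plpi _] := @plan_le_total_cost _ _ _ _ _ _ _ zero cz z0 _ _ _ mkappa rhoE mu.
  apply: (@le_lt_trans _ _ 0); last exact: ltry.
  rewrite /total_cost -(integral0 nu setT); apply: ge0_le_integral => //.
  - by move=> z _; exact: transport_cost_ge0.
  - exact: measurable_transport_cost.
  move=> z _; apply: ereal_inf_lbound; exists (kappa z \x mu)%E; last exact: integral0.
  split=> A mA.
    transitivity ((kappa z \x mu)%E (A `*` setT)).
      by congr ((_ \x _)%E _); apply/seteqP; split=> -[x y] //= [].
    transitivity (kappa z A * mu setT); first exact: product_measure1E.
    by rewrite probability_setT mule1.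
  transitivity ((kappa z \x mu)%E (setT `*` A)).
    by congr ((_ \x _)%E _); apply/seteqP; split=> -[x y] //= [].
  transitivity (kappa z setT * mu A); first exact: product_measure1E.
  by rewrite probability_setT mul1e.
by exists pi.
Qed.

Theorem theorem1 (R : realType) (dX dY dZ : measure_display)
  (X : polishType R dX) (Y : polishType R dY) (Z : polishType R dZ)
  (c : X * Y -> R) (hc : continuous c) (hcb : has_lbound (range c))
  (rho : probability (X * Z)%type R) (nu : probability Z R)
  (hnu : measure_eq (distribution rho projsnd) nu)
  (kappa : Z -> probability X R) (hkappa : is_disintegration rho nu kappa) :
  (forall mu : probability Y R,
     integral_well_defined nu (fun z => transport_cost c (kappa z) mu) /\
     is_minimum [set triple_cost c pi | pi in plans_to rho nu mu]
       (total_cost c nu kappa mu)) /\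
  (locally_uniformly_coercive c -> heine_borel Y ->
     [/\ exists mu : probability Y R, is_barycenter c nu kappa mu,
         exists v : \bar R,
           is_minimum (range (total_cost c nu kappa)) v /\
           is_minimum [set triple_cost c pi | pi in plans rho] v &
         forall pi, plans rho pi ->
           (forall pi', plans rho pi' -> triple_cost c pi <= triple_cost c pi') ->
           is_barycenter c nu kappa (distribution pi projY)]).
Proof.
have [a ca'] := hcb.
have ca p : (a <= c p)%R by apply: ca'; exists p.
have [mk0 rhoE] := hkappa.
have mkappa A : measurable A -> measurable_fun setT (fun z => kappa z A).
  by move=> mA; exact: measurable_weak_evaluation.
pose c' p : R := (c p - a)%R.
have c'0 := shifted_cost_ge0 ca.
have cc' : continuous c' := shifted_cost_continuous hc.
have triE (pi : probability (X * Y * Z)%type R) := triple_cost_shift hc ca pi.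
have totE mu := total_cost_shift hc ca nu mkappa mu.
have tot_le mu pi : plans_to rho nu mu pi -> total_cost c nu kappa mu <= triple_cost c pi.
  by move=> plpi; rewrite triE totE leeD2r//; exact: total_cost_le_triple_cost plpi.
have le_tot mu : exists2 pi, plans_to rho nu mu pi & triple_cost c pi = total_cost c nu kappa mu.
  suff [pi plpi pile] : exists2 pi, plans_to rho nu mu pi &
      triple_cost c' pi <= total_cost c' nu kappa mu.
    by exists pi => //; apply/eqP; rewrite eq_le tot_le// andbT triE totE leeD2r.
  have [fin|] := ltP (total_cost c' nu kappa mu) +oo.
    exact: plan_le_total_cost fin.
  rewrite leye_eq => /eqP ->.
  have [pi plpi] := plans_to_nonempty mkappa rhoE mu.
  by exists pi => //; exact: leey.
split=> [mu|coer hb].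
  split; first exact: (transport_cost_well_defined hc ca).
  by split=> [|_ [pi plpi <-]]; [have [pi ? ?] := le_tot mu; exists pi|exact: tot_le].
(* A competitor mu is realised by a plan whose cost is the total cost of mu, and pi is itself a plan
   over its own Y-marginal. *)
have bary pi : plans rho pi -> (forall pi', plans rho pi' -> triple_cost c pi <= triple_cost c pi') ->
    is_barycenter c nu kappa (distribution pi projY).
  move=> plpi pimin mu; have [pi' plpi' <-] := le_tot mu.
  apply: le_trans (pimin _ (plans_to_plans hnu plpi')).
  by apply: tot_le; exact: plans_plans_to.
have [|pi plpi pimin'] := exists_minimal_plan hnu hc ca _ coer hb.
  have [q plq] := plans_to_nonempty mkappa rhoE (point : probability Y R).
  by exists q; exact: plans_to_plans plq.
have pimin pi' : plans rho pi' -> triple_cost c pi <= triple_cost c pi'.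
  by move=> plpi'; rewrite !triE leeD2r//; exact: pimin'.
have bpi := bary _ plpi pimin.
(* pi is minimal in particular among the plans with its Y-marginal, and one of these attains the
   total cost. *)
have pitot : total_cost c nu kappa (distribution pi projY) = triple_cost c pi.
  apply/eqP; rewrite eq_le tot_le//=; last exact: plans_plans_to.
  have [pi' plpi' <-] := le_tot (distribution pi projY).
  exact: pimin (plans_to_plans hnu plpi').
split=> //; first by exists (distribution pi projY).
exists (triple_cost c pi); split.
  split; first by exists (distribution pi projY).
  by move=> _ [mu _ <-]; rewrite -pitot.
by split; [exists pi|move=> _ [pi' plpi' <-]; exact: pimin].
Qed.
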